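(* Let $\tilde{\boldsymbol e},\tilde{\boldsymbol s}\in[L^2(\Omega)]^{d}$ and $q\in L^2(\Omega)$. The following problem ($P_{\mathrm p}$, the primal problem) is well posed: find $\boldsymbol x=(\boldsymbol y,\boldsymbol z)\in X_{\mathrm p}=Y_{\mathrm p}\times Z_{\mathrm p}$, with $\boldsymbol y=(u,\boldsymbol e,\boldsymbol s)$ and $\boldsymbol z=(\lambda,\boldsymbol\mu)$, such that $$a_{\mathrm p}(\boldsymbol y,\delta\boldsymbol y)+b_{\mathrm p}(\delta\boldsymbol y,\boldsymbol z)=(\tilde{\boldsymbol e},\delta\boldsymbol e)+\kappa(\tilde{\boldsymbol s},\delta\boldsymbol s)\quad\forall\,\delta\boldsymbol y=(\delta u,\delta\boldsymbol e,\delta\boldsymbol s)\in Y_{\mathrm p},$$ $$b_{\mathrm p}(\boldsymbol y,\delta\boldsymbol z)=(q,\delta\lambda)\quad\forall\,\delta\boldsymbol z=(\delta\lambda,\delta\boldsymbol\mu)\in Z_{\mathrm p}.$$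
   Context: $\Omega\subset\mathbb R^{d}$, $d\in\{2,3\}$, is a bounded connected open set with Lipschitz boundary; $(\cdot,\cdot)$ and $\|\cdot\|$ are the $L^2(\Omega)$ inner product and norm (scalar or vector valued). The reaction coefficient $\zeta>0$, the scale parameter $\kappa>0$ and the characteristic length $\ell>0$ of $\Omega$ are constants. $Y_{\mathrm p}=H^1_0(\Omega)\times[L^2(\Omega)]^d\times[L^2(\Omega)]^d$ (elements $\boldsymbol y=(u,\boldsymbol e,\boldsymbol s)$), with norm $\|\boldsymbol y\|_{Y_{\mathrm p}}^2=\ell^{-2}\|u\|^2+\|\nabla u\|^2+\|\boldsymbol e\|^2+\kappa\|\boldsymbol s\|^2$. $Z_{\mathrm p}=H^1_0(\Omega)\times[L^2(\Omega)]^d$ (elements $\boldsymbol z=(\lambda,\boldsymbol\mu)$), with norm $\|\boldsymbol z\|_{Z_{\mathrm p}}^2=\kappa^{-1}\ell^{-2}\|\lambda\|^2+\kappa^{-1}\|\nabla\lambda\|^2+\|\boldsymbol\mu\|^2$. For $\boldsymbol y_i=(u_i,\boldsymbol e_i,\boldsymbol s_i)\in Y_{\mathrm p}$: $a_{\mathrm p}(\boldsymbol y_1,\boldsymbol y_2)=(\boldsymbol e_1,\boldsymbol e_2)+\kappa(\boldsymbol s_1,\boldsymbol s_2)$. For $\boldsymbol y\in Y_{\mathrm p}$, $\boldsymbol z\in Z_{\mathrm p}$: $b_{\mathrm p}(\boldsymbol y,\boldsymbol z)=-(\nabla\lambda,\boldsymbol s)+\zeta(\lambda,u)+(\boldsymbol\mu,\boldsymbol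 e-\nabla u)$. ''Well posed'' means: for all data $(\tilde{\boldsymbol e},\tilde{\boldsymbol s},q)$ there is exactly one solution, and it depends continuously on $(\tilde{\boldsymbol e},\tilde{\boldsymbol s},q)$. *)

(* Defs.v *)
From HB Require Import structures.
From mathcomp Require Import all_boot all_order all_algebra.
From mathcomp Require Import all_classical all_reals all_analysis.

Set Implicit Arguments.
Unset Strict Implicit.
Unset Printing Implicit Defensive.

Import Order.TTheory GRing.Theory Num.Theory.
Import numFieldNormedType.Exports.

Local Open Scope classical_set_scope.
Local Open Scope ring_scope.

(* Borel sigma-algebra of 'rV[R]_n, generated by the coordinate maps. *)

Definition rV_display : measure_display. Proof. exact: default_measure_display. Qed.

Section rV_measurable.
Context (R : realType) (n : nat).

Let coord (i : 'I_n) (x : 'rV[R]_n) : measurableTypeR R := x 0 i.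

Let rV_set0 : g_sigma_preimage coord set0.
Proof. exact: sigma_algebra0. Qed.

Let rV_setC A : g_sigma_preimage coord A -> g_sigma_preimage coord (~` A).
Proof. exact: sigma_algebraC. Qed.

Let rV_bigcup (F : (set 'rV[R]_n)^nat) :
  (forall i, g_sigma_preimage coord (F i)) ->
  g_sigma_preimage coord (\bigcup_i (F i)).
Proof. exact: sigma_algebra_bigcup. Qed.

HB.instance Definition _ := @isMeasurable.Build rV_display 'rV[R]_n
  (g_sigma_preimage coord) rV_set0 rV_setC rV_bigcup.

Lemma measurable_coord (i : 'I_n) :
  measurable_fun [set: 'rV[R]_n] (fun x : 'rV[R]_n => x 0 i : measurableTypeR R).
Proof.
move=> _ Y mY; rewrite setTI; apply: sub_sigma_algebra => /=.
rewrite -bigcup_seq/=; exists i => /=; first by rewrite mem_index_enum.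
by exists Y => //; rewrite setTI.
Qed.

Lemma measurable_fun_coordP d1 (T1 : measurableType d1) (f : T1 -> 'rV[R]_n) :
  measurable_fun [set: T1] f <->
  forall i, measurable_fun [set: T1] (fun x => f x 0 i : measurableTypeR R).
Proof.
split=> [mf i|mf]; first exact: measurableT_comp (measurable_coord i) mf.
suff sub : g_sigma_preimage (fun i => coord i \o f) `<=` measurable.
  move=> _ A mA; rewrite setTI; apply: sub.
  by rewrite g_sigma_preimage_comp; exists A => //; rewrite setTI.
apply: smallest_sub; first exact: sigma_algebra_measurable.
rewrite -bigcup_seq/= => A [i /= _ [B mB <-]].
exact: mf.
Qed.

End rV_measurable.

Lemma pushforward_semi_sigma_additive d1 d2 (T1 : measurableType d1)
    (T2 : measurableType d2) (R : realType) (m : {measure set T1 -> \bar R})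
    (f : T1 -> T2) :
  measurable_fun setT f -> semi_sigma_additive (pushforward m f).
Proof.
move=> mf F mF tF mUF; rewrite /pushforward preimage_bigcup.
have mpre A : measurable A -> measurable (f @^-1` A).
  by move=> mA; rewrite -[X in measurable X]setTI; exact: mf.
apply: measure_semi_sigma_additive.
- by move=> k; exact/mpre.
- apply/trivIsetP => /= i j _ _ ij; rewrite -preimage_setI.
  by move/trivIsetP : tF => /(_ _ _ _ _ ij) ->//; rewrite preimage_set0.
- by rewrite -preimage_bigcup; exact/mpre.
Qed.

Lemma product_sigma_finite d1 d2 (T1 : measurableType d1)
    (T2 : measurableType d2) (R : realType)
    (m1 : {sigma_finite_measure set T1 -> \bar R})
    (m2 : {sigma_finite_measure set T2 -> \bar R}) :
  sigma_finite setT (m1 \x m2)%E.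
Proof.
have /sigma_finiteP[F [TF ndF Foo]] := sigma_finiteT m1.
have /sigma_finiteP[G [TG ndG Goo]] := sigma_finiteT m2.
exists (fun n => F n `*` G n).
 rewrite -setXTT TF TG predeqE => -[x y]; split.
    move=> [/= [n _ Fnx] [k _ Gky]]; exists (maxn n k) => //; split.
    - by move: x Fnx; exact/subsetPset/ndF/leq_maxl.
    - by move: y Gky; exact/subsetPset/ndG/leq_maxr.
  by move=> [n _ []/= ? ?]; split; exists n.
move=> k; have [? ?] := Foo k; have [? ?] := Goo k.
split; first exact: measurableX.
by rewrite product_measure1E// lte_mul_pinfty// ge0_fin_numE.
Qed.

Section lebesgue_rV.
Context (R : realType).

Definition cons_rV n (p : measurableTypeR R * 'rV[R]_n) : 'rV[R]_n.+1 :=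
  row_mx (const_mx p.1 : 'rV_1) p.2.

Lemma cons_rV0 n p : @cons_rV n p 0 0 = p.1.
Proof.
rewrite (_ : 0 = lshift n 0 :> 'I_(1 + n)); last exact/val_inj.
exact: etrans (row_mxEl _ _ _ _) (mxE _ _ _ _).
Qed.

Lemma cons_rVS n p j : @cons_rV n p 0 (lift 0 j) = p.2 0 j.
Proof.
rewrite (_ : lift 0 j = rshift 1 j :> 'I_(1 + n)); last exact/val_inj.
exact: row_mxEr.
Qed.

Lemma measurable_cons_rV n : measurable_fun setT (@cons_rV n).
Proof.
apply/measurable_fun_coordP => i; case: (unliftP 0 i) => [j|] ->.
  rewrite (_ : (fun _ => _) = (fun x : 'rV_n => x 0 j) \o snd).
    exact: measurableT_comp (measurable_coord _) _.
  by apply/funext => p; rewrite cons_rVS.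
by rewrite (_ : (fun _ => _) = fst) //; apply/funext => p; rewrite cons_rV0.
Qed.

Section step.
Context (n : nat) (mu : {sigma_finite_measure set 'rV[R]_n -> \bar R}).

Definition lebesgue_rVS : set 'rV[R]_n.+1 -> \bar R :=
  pushforward (lebesgue_measure \x mu)%E (@cons_rV n).

Let nu0 : lebesgue_rVS set0 = 0%E.
Proof. by rewrite /lebesgue_rVS /pushforward preimage_set0 measure0. Qed.

Let nu_ge0 A : (0 <= lebesgue_rVS A)%E.
Proof. by rewrite /lebesgue_rVS /pushforward measure_ge0. Qed.

Let nu_sigma_additive : semi_sigma_additive lebesgue_rVS.
Proof.
exact: pushforward_semi_sigma_additive (@measurable_cons_rV n).
Qed.

HB.instance Definition _ := isMeasure.Build _ _ _ lebesgue_rVS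
  nu0 nu_ge0 nu_sigma_additive.

Let nu_sigma_finite : sigma_finite setT lebesgue_rVS.
Proof.
have [F TF Foo] : sigma_finite setT (lebesgue_measure \x mu)%E.
  exact: product_sigma_finite.
have mun : measurable_fun setT (fun x : 'rV[R]_n.+1 =>
    (x 0 0 : measurableTypeR R, (\row_j x 0 (lift 0 j)) : 'rV[R]_n)).
  apply: measurable_fun_pair; first exact: measurable_coord.
  apply/measurable_fun_coordP => i.
  rewrite (_ : (fun _ => _) = (fun x : 'rV_n.+1 => x 0 (lift 0 i))).
    exact: measurable_coord.
  by apply/funext => x; rewrite mxE.
set g := (fun x => _) in mun.
exists (fun k => g @^-1` F k).
  by rewrite -preimage_bigcup -TF preimage_setT.
move=> k; have [mF Fk] := Foo k; split.
  by rewrite -[X in measurable X]setTI; exact: mun.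
rewrite /lebesgue_rVS /pushforward -comp_preimage.
rewrite (_ : g \o _ = id)//.
apply/funext => p; rewrite /g /= cons_rV0 [RHS]surjective_pairing; congr pair.
by apply/rowP => j; rewrite mxE cons_rVS.
Qed.

HB.instance Definition _ := Measure_isSigmaFinite.Build _ _ _ lebesgue_rVS
  nu_sigma_finite.

End step.

Fixpoint lebesgue_rV n : {sigma_finite_measure set 'rV[R]_n -> \bar R} :=
  if n is n'.+1 then lebesgue_rVS (lebesgue_rV n') else \d_(0 : 'rV[R]_0).

End lebesgue_rV.

Section sobolev.
Context (R : realType) (d : nat) (Omega : set 'rV[R]_d).

Local Notation E := 'rV[R]_d.
Local Notation mu := (lebesgue_rV R d).

(* Elements of L^2(Omega) are represented by functions on the whole space, of
   which only the values on Omega matter, up to [ae_eq mu Omega]. *)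
Definition L2 (f : E -> R) : Prop := f \_ Omega \in Lfun mu 2%:E.

Definition L2dot (f g : E -> R) : R := \int[mu]_(x in Omega) (f x * g x).

Definition L2norm (f : E -> R) : R := Num.sqrt (L2dot f f).

Definition L2v (F : E -> E) : Prop := forall i, L2 (fun x => F x 0 i).

Definition L2dotv (F G : E -> E) : R :=
  \int[mu]_(x in Omega) (\sum_i F x 0 i * G x 0 i).

Definition L2normv (F : E -> E) : R := Num.sqrt (L2dotv F F).

Definition partial (i : 'I_d) (phi : E -> R) (x : E) : R :=
  'D_(delta_mx 0 i) phi x.

Definition grad (phi : E -> R) (x : E) : E := \row_i partial i phi x.

Fixpoint class_C (k : nat) (phi : E -> R) : Prop :=
  continuous phi /\
  if k is k'.+1 then
    forall i, (forall x, derivable phi x (delta_mx 0 i)) /\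
              class_C k' (partial i phi)
  else True.

Definition test_function (phi : E -> R) : Prop :=
  (forall k, class_C k phi) /\
  exists K : set E,
    [/\ compact K, K `<=` Omega & forall x, ~ K x -> phi x = 0].

Definition weak_gradient (u : E -> R) (Du : E -> E) : Prop :=
  forall phi i, test_function phi ->
    L2dot u (partial i phi) = - L2dot (fun x => Du x 0 i) phi.

(* Elements of H^1 are given together with their weak gradient, which the
   function determines up to a null set: [H1 (u, Du)] means that u is in
   H^1(Omega) and that Du represents its weak gradient. *)
Definition H1 (w : (E -> R) * (E -> E)) : Prop :=
  [/\ L2 w.1, L2v w.2 & weak_gradient w.1 w.2].

Definition H1_0 (w : (E -> R) * (E -> E)) : Prop :=
  H1 w /\
  forall eps : R, 0 < eps -> exists2 phi, test_function phi &
    L2norm (w.1 - phi) ^+ 2 + L2normv (w.2 - grad phi) ^+ 2 < eps ^+ 2.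

(* After an orthogonal change of coordinates, Omega is near every boundary
   point the strict epigraph, in the direction of some coordinate i, of a
   Lipschitz function of the d - 1 other coordinates. *)
Definition Lipschitz_boundary : Prop :=
  forall x0, (closure Omega `\` interior Omega) x0 ->
  exists (Q : 'M[R]_d) (i : 'I_d) (gamma : 'rV[R]_d.-1 -> R) (L : R),
    [/\ Q *m Q^T = 1%:M,
        forall y y', `|gamma y - gamma y'| <= L * `|y - y'| &
        \forall x \near x0,
          Omega x <-> gamma (col' i (x *m Q)) < (x *m Q) 0 i].

End sobolev.

(* The solutions of a problem [sol f x] with data f in D and unknown x in X,
   where data and unknowns are measured by normD and normX and unknowns are
   identified by eqX. *)
Definition well_posed (R : realType) (DT XT : zmodType)
    (D : DT -> Prop) (normD : DT -> R)
    (X : XT -> Prop) (normX : XT -> R) (eqX : XT -> XT -> Prop)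
    (sol : DT -> XT -> Prop) : Prop :=
  [/\ forall f, D f -> exists2 x, X x & sol f x,
      forall f x x', D f -> X x -> X x' -> sol f x -> sol f x' -> eqX x x' &
      forall f x, D f -> X x -> sol f x -> forall eps : R, 0 < eps ->
        exists2 delta : R, 0 < delta &
          forall f' x', D f' -> X x' -> sol f' x' ->
            normD (f' - f) < delta -> normX (x' - x) < eps].

Section primal_problem.
Context (R : realType) (d : nat) (Omega : set 'rV[R]_d) (zeta kappa ell : R).

Local Notation E := 'rV[R]_d.
Local Notation mu := (lebesgue_rV R d).
Local Notation dot := (L2dot Omega).
Local Notation dotv := (L2dotv Omega).
Local Notation norm := (L2norm Omega).
Local Notation normv := (L2normv Omega).

(* y = (u, e, s) and z = (lambda, m), the H^1 components u and lambda being
   accompanied by their weak gradients. *)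
Definition Y_p_type : zmodType :=
  (((E -> R) * (E -> E)) * (E -> E) * (E -> E))%type.
Definition Z_p_type : zmodType := (((E -> R) * (E -> E)) * (E -> E))%type.
Definition X_p_type : zmodType := (Y_p_type * Z_p_type)%type.
Definition data_type : zmodType := ((E -> E) * (E -> E) * (E -> R))%type.

Definition Y_p (y : Y_p_type) : Prop :=
  let: (u, e, s) := y in [/\ H1_0 Omega u, L2v Omega e & L2v Omega s].

Definition Z_p (z : Z_p_type) : Prop :=
  let: (lam, m) := z in H1_0 Omega lam /\ L2v Omega m.

Definition X_p (x : X_p_type) : Prop := Y_p x.1 /\ Z_p x.2.

Definition Y_p_norm (y : Y_p_type) : R :=
  let: ((u, Du), e, s) := y in
  Num.sqrt (ell ^- 2 * norm u ^+ 2 + normv Du ^+ 2 + normv e ^+ 2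
            + kappa * normv s ^+ 2).

Definition Z_p_norm (z : Z_p_type) : R :=
  let: ((lam, Dlam), m) := z in
  Num.sqrt (kappa^-1 * ell ^- 2 * norm lam ^+ 2 + kappa^-1 * normv Dlam ^+ 2
            + normv m ^+ 2).

Definition X_p_norm (x : X_p_type) : R :=
  Num.sqrt (Y_p_norm x.1 ^+ 2 + Z_p_norm x.2 ^+ 2).

Definition X_p_eq (x x' : X_p_type) : Prop :=
  let: (((u, Du), e, s), ((lam, Dlam), m)) := x in
  let: (((u', Du'), e', s'), ((lam', Dlam'), m')) := x' in
  [/\ ae_eq mu Omega u u' /\ ae_eq mu Omega Du Du',
      ae_eq mu Omega e e', ae_eq mu Omega s s',
      ae_eq mu Omega lam lam' /\ ae_eq mu Omega Dlam Dlam' &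
      ae_eq mu Omega m m'].

Definition data (f : data_type) : Prop :=
  let: (et, st, q) := f in [/\ L2v Omega et, L2v Omega st & L2 Omega q].

Definition data_norm (f : data_type) : R :=
  let: (et, st, q) := f in
  Num.sqrt (normv et ^+ 2 + normv st ^+ 2 + norm q ^+ 2).

Definition a_p (y1 y2 : Y_p_type) : R :=
  let: (_, e1, s1) := y1 in
  let: (_, e2, s2) := y2 in
  dotv e1 e2 + kappa * dotv s1 s2.

Definition b_p (y : Y_p_type) (z : Z_p_type) : R :=
  let: ((u, Du), e, s) := y in
  let: ((lam, Dlam), m) := z in
  - dotv Dlam s + zeta * dot lam u + dotv m (e - Du).

Definition P_p_solution (f : data_type) (x : X_p_type) : Prop :=
  let: (et, st, q) := f in
  let: (y, z) := x in
  (forall dy, Y_p dy ->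
     let: (_, de, ds) := dy in
     a_p y dy + b_p dy z = dotv et de + kappa * dotv st ds) /\
  (forall dz, Z_p dz ->
     let: ((dlam, _), _) := dz in
     b_p y dz = dot q dlam).

End primal_problem.

(* Main.v *)
Require Import Defs.
From HB Require Import structures.
From mathcomp Require Import all_boot all_order all_algebra.
From mathcomp Require Import all_classical all_reals all_analysis.
From mathcomp Require Import measurable_realfun ring lra.
Import Order.TTheory GRing.Theory Num.Theory.
Import numFieldNormedType.Exports.

(* Eliminating e = grad u, m = et - grad u and s = st + grad lambda / kappa turns
   the system into: find (u, lambda) in H^1_0 x H^1_0 such that
     (grad u, grad v) + zeta (lambda, v) = (et, grad v)  for all v,
     kappa^-1 (grad lambda, grad w) - zeta (u, w) = - (q, w) - (st, grad w)
   for all w. The zeta terms are skew, so that the form is coercive by the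
   Poincare inequality, and Lax-Milgram applies. Testing the equations with the
   solution itself bounds its norm by that of the data; by linearity this gives
   both uniqueness and continuous dependence.

   The Poincare inequality for a test function phi comes from integrating
   d_0 (x_0 phi^2) = phi^2 + 2 x_0 phi d_0 phi to 0. *)

Set Implicit Arguments.
Unset Strict Implicit.
Unset Printing Implicit Defensive.

Local Open Scope classical_set_scope.
Local Open Scope ring_scope.

(** * Riesz and Lax-Milgram in semidefinite inner product spaces *)

(** The form [a_p] controls only e and s, so it gives no bound on u; after the elimination both
    gradients stand on the diagonal, and the two terms without a sign cancel when the unknown tests
    itself.

    Two obstacles shape the development. Elements of L^2 are functions, not classes: inner products
    have null vectors, and a map obtained by choosing Riesz representatives is linear only up to
    them. The Hilbert space arguments therefore use squared norms on a subset [V], and null vectors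
    become almost everywhere equality only when uniqueness is concluded. Moreover, the measure on
    row vectors is defined by recursion, splitting off coordinate 0; hence the choice of that
    coordinate in the Poincare inequality, and the integration slice by slice.

    H^1_0 is treated inside the space of all pairs in L^2 x [L^2]^d, so that its completeness
    reduces to that of L^2 and to closedness. The stability estimate concerns an arbitrary solution
    of the full problem, tested one component at a time, so that uniqueness does not pass through
    the reduced problem. *)

Lemma discriminant_le (R : realFieldType) (a b c : R) : 0 <= c ->
  (forall t, 0 <= a + t * b *+ 2 + t ^+ 2 * c) -> b ^+ 2 <= a * c.
Proof.
move=> c0 h; have a0 : 0 <= a by move: (h 0); rewrite !mul0r expr0n/= mul0r; lra.
have [c0'|cn0] := eqVneq c 0.
  have [->|bn0] := eqVneq b 0; first by rewrite expr0n/= mulr_ge0.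
  (* With c = 0 the expression is affine in t, and this t gives it the value -1. *)
  move: (h (- (a + 1) / (b *+ 2))); rewrite c0' mulr0 addr0.
  rewrite -mulrnAr -mulrA mulVf ?mulr1; first by lra.
  by rewrite mulrn_eq0.
have cp : 0 < c by rewrite lt_neqAle eq_sym cn0.
move: (h (- b / c)); rewrite -(pmulr_rge0 _ cp).
have -> : c * (a + - b / c * b *+ 2 + (- b / c) ^+ 2 * c) = a * c - b ^+ 2.
  by field.
by rewrite subr_ge0.
Qed.

Lemma inv_lt_eventually (R : archiRealFieldType) (e : R) : 0 < e ->
  exists N, forall n, (N <= n)%N -> n.+1%:R^-1 < e.
Proof.
move=> e0; exists (Num.truncn e^-1).+1 => n hn.
rewrite -[e]invrK ltf_pV2 ?posrE ?invr_gt0 //.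
by rewrite (lt_le_trans (truncnS_gt _)) // ler_nat leqW.
Qed.

Lemma sqr_le_eps_eq0 (R : realFieldType) (x q : R) : 0 <= q ->
  (forall e, 0 < e -> x ^+ 2 <= e * q) -> x = 0.
Proof.
move=> q0 h; apply/eqP; rewrite -sqrf_eq0 eq_le sqr_ge0 andbT leNgt.
apply/negP => hp; have q1 : 0 < q + 1 by rewrite ltr_wpDl.
(* At e = x^2 / (q + 1) the hypothesis reads x^2 (q + 1) <= x^2 q; the 1 covers q = 0. *)
have := h _ (divr_gt0 hp q1).
by rewrite mulrAC ler_pdivlMr // mulrDr mulr1 gerDl leNgt hp.
Qed.

Section semi_inner_product.
Context {R : realType} {W : lmodType R}.
Implicit Types (V : W -> Prop) (dot : W -> W -> R) (u v w : W).

(* [dot] is only required to be semidefinite: the spaces of interest are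
   spaces of functions, not of classes of functions. *)
Record prehilbert V dot : Prop := Prehilbert {
  prehilbert0 : V 0;
  prehilbertDZ : forall a u v, V u -> V v -> V (a *: u + v);
  dotC : forall u v, V u -> V v -> dot u v = dot v u;
  dotDZl : forall a u v w, V u -> V v -> V w ->
    dot (a *: u + v) w = a * dot u w + dot v w;
  dot_ge0 : forall u, V u -> 0 <= dot u u }.

(** Spelled out with squared norms, since a semidefinite form does not make [W] a normed space;
    limits are determined only up to null vectors. *)
Definition sqcvg dot (u : nat -> W) l := forall eps : R, 0 < eps ->
  exists N, forall n, (N <= n)%N -> dot (u n - l) (u n - l) < eps.

Definition sqcauchy dot (u : nat -> W) := forall eps : R, 0 < eps ->
  exists N, forall m n, (N <= m)%N -> (N <= n)%N ->
    dot (u m - u n) (u m - u n) < eps.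

Definition sqcomplete V dot := forall u : nat -> W, (forall n, V (u n)) ->
  sqcauchy dot u -> exists2 l, V l & sqcvg dot u l.

Definition linear_on V (F : W -> R) := forall a u v, V u -> V v ->
  F (a *: u + v) = a * F u + F v.

Section theory.
Variables (V : W -> Prop) (dot : W -> W -> R).
Hypothesis H : prehilbert V dot.

Lemma subspaceD u v : V u -> V v -> V (u + v).
Proof. by move=> Vu Vv; rewrite -[u]scale1r; exact: prehilbertDZ H _ _ _ Vu Vv. Qed.

Lemma subspaceZ a u : V u -> V (a *: u).
Proof.
move=> Vu; rewrite -[_ *: _]addr0.
by apply: (prehilbertDZ H) => //; exact: prehilbert0 H.
Qed.

Lemma subspaceN u : V u -> V (- u).
Proof. by rewrite -scaleN1r; exact: subspaceZ. Qed.

Lemma subspaceB u v : V u -> V v -> V (u - v).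
Proof. by move=> Vu Vv; apply: subspaceD => //; exact: subspaceN. Qed.

Lemma linear_on0 F : linear_on V F -> F 0 = 0.
Proof.
have V0 := prehilbert0 H.
move=> /(_ 1 0 0 V0 V0); rewrite scaler0 addr0; lra.
Qed.

Lemma linear_onZ F a u : linear_on V F -> V u -> F (a *: u) = a * F u.
Proof.
move=> lF Vu; rewrite -[_ *: _]addr0 lF ?(linear_on0 lF) ?addr0 //.
exact: prehilbert0 H.
Qed.

Lemma linear_onD F u v : linear_on V F -> V u -> V v -> F (u + v) = F u + F v.
Proof. by move=> lF Vu Vv; rewrite -[u]scale1r lF // mul1r scale1r. Qed.

Lemma linear_onB F u v : linear_on V F -> V u -> V v -> F (u - v) = F u - F v.
Proof.
move=> lF Vu Vv; rewrite linear_onD //; last exact: subspaceN.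
by rewrite -scaleN1r linear_onZ // mulN1r.
Qed.

Lemma linear_dotl w : V w -> linear_on V (dot^~ w).
Proof. by move=> Vw a u v Vu Vv; exact: dotDZl H _ _ _ _ Vu Vv Vw. Qed.

Lemma linear_dotr w : V w -> linear_on V (dot w).
Proof.
move=> Vw a u v Vu Vv; rewrite !(dotC H Vw) //; last exact: prehilbertDZ H _ _ _ Vu Vv.
exact: linear_dotl.
Qed.

Lemma dot_sqrDZ t u v : V u -> V v ->
  dot (u + t *: v) (u + t *: v)
    = dot u u + t * dot u v *+ 2 + t ^+ 2 * dot v v.
Proof.
move=> Vu Vv; have Vtv : V (t *: v) by exact: subspaceZ.
have Vs : V (u + t *: v) by exact: subspaceD.
rewrite (linear_onD (linear_dotl Vs)) // (linear_onZ t (linear_dotl Vs)) //.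
rewrite !(linear_onD (linear_dotr _)) // !(linear_onZ t (linear_dotr _)) //.
by rewrite (dotC H Vv Vu); ring.
Qed.

Lemma cauchy_schwarz u v : V u -> V v -> dot u v ^+ 2 <= dot u u * dot v v.
Proof.
move=> Vu Vv; apply: discriminant_le; first exact: dot_ge0 H _ Vv.
move=> t; rewrite -dot_sqrDZ //; apply: (dot_ge0 H).
by apply: subspaceD => //; exact: subspaceZ.
Qed.

Lemma dot_sqrD_le u v : V u -> V v ->
  dot (u + v) (u + v) <= 2 * dot u u + 2 * dot v v.
Proof.
move=> Vu Vv; have Vn : V (-1 *: v) by exact: subspaceZ.
have := dot_ge0 H (subspaceD Vu Vn).
by have := dot_sqrDZ 1 Vu Vv; rewrite scale1r => ->; rewrite dot_sqrDZ //; lra.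
Qed.

Lemma dot_sqrDZ_le a u v : V u -> V v ->
  dot (a *: u + v) (a *: u + v) <= 2 * a ^+ 2 * dot u u + 2 * dot v v.
Proof.
move=> Vu Vv; have Vau := subspaceZ a Vu.
apply: le_trans (dot_sqrD_le Vau Vv) _.
rewrite (linear_onZ a (linear_dotl Vau)) // (linear_onZ a (linear_dotr Vu)) //.
by rewrite mulrA -expr2 mulrA.
Qed.

Lemma dot_sqrB u v : V u -> V v -> dot (u - v) (u - v) = dot (v - u) (v - u).
Proof.
move=> Vu Vv; rewrite -scaleN1r -[in RHS]scaleN1r !dot_sqrDZ // (dotC H Vv Vu).
by ring.
Qed.

(* The variational argument is run on the minimizing sequence, before passing
   to the limit: an infimum attained up to [eps] makes [S u v - F v] small. *)
Lemma riesz (F : W -> R) (C : R) : 0 <= C -> sqcomplete V dot -> linear_on V F ->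
  (forall v, V v -> F v ^+ 2 <= C * dot v v) ->
  exists2 u, V u & forall v, V v -> dot u v = F v.
Proof.
move=> C0 cV lF FC.
pose J v : R := dot v v - 2 * F v.
have JDZ t u v : V u -> V v -> J (u + t *: v) =
    J u + t * (dot u v - F v) *+ 2 + t ^+ 2 * dot v v.
  move=> Vu Vv; rewrite /J dot_sqrDZ // linear_onD //; last exact: subspaceZ.
  by rewrite (linear_onZ t lF) //; ring.
(* By the bound on [F] and the inequality of means, 2 |F v| <= [dot v v] + C. *)
have Jge v : V v -> - C <= J v.
  move=> Vv; have h := FC _ Vv; have d0 := dot_ge0 H Vv; rewrite /J.
  rewrite leNgt; apply/negP => lt_J.
  have : 0 <= (dot v v - C) ^+ 2 by exact: sqr_ge0.
  have : (dot v v + C) ^+ 2 < (2 * F v) ^+ 2.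
    by rewrite ltr_sqr ?nnegrE; lra.
  nra.
pose A : set R := [set J v | v in V].
have hA : has_inf A.
  split; first by exists (J 0), 0 => //; exact: prehilbert0 H.
  by exists (- C) => _ [v Vv <-]; exact: Jge.
have infJ v : V v -> inf A <= J v.
  by move=> Vv; apply: ge_inf; [exact: hA.2 | exists v].
have min_seq n : exists u, V u /\ J u < inf A + n.+1%:R^-1 :> R.
  have n0 : 0 < n.+1%:R^-1 :> R by rewrite invr_gt0.
  have [_ [u Vu <-] hu] := inf_adherent n0 hA.
  by exists u.
have [u hu] := choice min_seq.
have Vu n := (hu n).1.
have cu : sqcauchy dot u.
  move=> e e0.
  have [N hN] := inv_lt_eventually (divr_gt0 e0 (ltr0n _ 4)).
  exists N => m n hm hn.
  (* Parallelogram identity around the midpoint [u m + h]: the linear part of [J] cancels, and [J]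
     at the midpoint is at least the infimum, so the squared distance is below 2/(m+1) + 2/(n+1). *)
  have [h Vh unE] : exists2 h, V h & u n = u m + 2 *: h.
    exists (2^-1 *: (u n - u m)); first by apply: subspaceZ; exact: subspaceB.
    by rewrite scalerA mulfV // scale1r addrCA subrr addr0.
  have mid := infJ _ (subspaceD (Vu m) Vh).
  have := JDZ 1 _ _ (Vu m) Vh; have := JDZ 2 _ _ (Vu m) Vh.
  rewrite -unE scale1r => Jn Jmid.
  have -> : dot (u m - u n) (u m - u n) =
      2 * J (u m) + 2 * J (u n) - 4 * J (u m + h).
    have V2h : V (2 *: h) by exact: subspaceZ.
    rewrite dot_sqrB // {1 2}unE [u m + _]addrC addrK.
    rewrite (linear_onZ 2 (linear_dotl V2h)) // (linear_onZ 2 (linear_dotr Vh)) //.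
    by rewrite Jn Jmid; ring.
  have := hN _ hm; have := hN _ hn; have := (hu m).2; have := (hu n).2.
  have aux (x y z p q i : R) : i <= z -> y < i + q -> x < i + p ->
      q < e / 4 -> p < e / 4 -> 2 * x + 2 * y - 4 * z < e by lra.
  exact: aux.
have [l Vl hl] := cV _ Vu cu.
exists l => // v Vv.
have hn n : (dot (u n) v - F v) ^+ 2 <= n.+1%:R^-1 * dot v v.
  apply: discriminant_le => [|t]; first exact: dot_ge0 H _ Vv.
  have := infJ _ (subspaceD (Vu n) (subspaceZ t Vv)); rewrite JDZ //.
  have := (hu n).2.
  have aux (x y z i p : R) : x < i + p -> i <= x + y + z -> 0 <= p + y + z by lra.
  exact: aux.
have key (e : R) : 0 < e -> (dot l v - F v) ^+ 2 <= e * dot v v.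
  move=> e0.
  have e4 : 0 < e / 4 by rewrite divr_gt0.
  have [N1 hN1] := hl _ e4; have [N2 hN2] := inv_lt_eventually e4.
  pose n := maxn N1 N2.
  have h1 := hN1 n (leq_maxl _ _); have h2 := hN2 n (leq_maxr _ _).
  have h3 := cauchy_schwarz (subspaceB (Vu n) Vl) Vv.
  rewrite (linear_onB (linear_dotl Vv)) // in h3.
  have h4 := hn n; have d0 := dot_ge0 H Vv.
  have aux (x y f p k q : R) : 0 <= q -> p < e / 4 -> k < e / 4 ->
      (x - y) ^+ 2 <= p * q -> (x - f) ^+ 2 <= k * q -> (y - f) ^+ 2 <= e * q.
    move=> q0 pe ke xy xf; have := sqr_ge0 ((x - f) + (x - y)).
    have : p * q <= e / 4 * q by rewrite ler_wpM2r // ltW.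
    have : k * q <= e / 4 * q by rewrite ler_wpM2r // ltW.
    nra.
  exact: aux d0 h1 h2 h3 h4.
by apply/subr0_eq/sqr_le_eps_eq0; [exact: dot_ge0 H _ Vv|exact: key].
Qed.

End theory.

(* [A] maps [u] to the Riesz representative of [B u]. The form [(A u, A v)] is
   symmetric, equivalent to [dot], and representing [(f, A v)] with it gives [u]
   such that [r = A u - f] is orthogonal to the range of [A]; coercivity applied
   to [B r r = (A r, r) = 0] then shows that [r] is null. *)
Lemma lax_milgram (V : W -> Prop) (dot B : W -> W -> R) (F : W -> R)
    (c C : R) :
  prehilbert V dot -> sqcomplete V dot -> 0 < c -> 0 <= C ->
  (forall w, V w -> linear_on V (B^~ w)) ->
  (forall w, V w -> linear_on V (B w)) ->
  (forall u v, V u -> V v -> B u v ^+ 2 <= C * dot u u * dot v v) ->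
  (forall u, V u -> c * dot u u <= B u u) ->
  linear_on V F -> (forall v, V v -> F v ^+ 2 <= C * dot v v) ->
  exists2 u, V u & forall v, V v -> B u v = F v.
Proof.
move=> H cV c0 C0 lBl lBr BC Bc lF FC.
have exA u : exists a, V u -> V a /\ forall v, V v -> dot a v = B u v.
  have [Vu|nVu] := pselect (V u); last by exists 0.
  have [a Va ha] := riesz H (mulr_ge0 C0 (dot_ge0 H Vu)) cV (lBr _ Vu) (BC _^~ Vu).
  by exists a.
have [A hA] := choice exA.
have VA u : V u -> V (A u) by move=> /hA[].
have dotA u v : V u -> V v -> dot (A u) v = B u v by move=> /hA[_]; exact.
pose S u v := dot (A u) (A v).
(* [A] is linear only up to null vectors, but [S u v] equals [B u (A v)], which is linear in [u];
   symmetry comes from [dot]. *)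
have preS : prehilbert V S.
  split.
  - exact: prehilbert0 H.
  - exact: prehilbertDZ H.
  - by move=> u v Vu Vv; rewrite /S (dotC H) //; exact: VA.
  - move=> a u v w Vu Vv Vw; rewrite /S !dotA //; try exact: VA.
      by rewrite lBl //; exact: VA.
    exact: prehilbertDZ H _ _ _ Vu Vv.
  - by move=> u Vu; apply: (dot_ge0 H); exact: VA.
(* The bound on [B] at the pair [u], [A u] reads S^2 <= C (u, u) S, where S stands for [S u u]. With
   the lower bound [geS], obtained from Cauchy-Schwarz and coercivity, it transfers completeness
   from [dot] to [S]. *)
have leS u : V u -> S u u <= C * dot u u.
  move=> Vu; have := BC _ _ Vu (VA _ Vu); rewrite -dotA //; last exact: VA.
  rewrite -/(S u u).
  have := dot_ge0 preS Vu; rewrite le_eqVlt => /predU1P[<- _|S0].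
    by rewrite mulr_ge0 // (dot_ge0 H).
  by rewrite expr2 ler_pM2r.
have geS u : V u -> c ^+ 2 * dot u u <= S u u.
  move=> Vu; have := cauchy_schwarz H (VA _ Vu) Vu; rewrite dotA // -/(S u u).
  have d0 := dot_ge0 H Vu; have := Bc _ Vu.
  move: d0; rewrite le_eqVlt => /predU1P[<- _ _|d0 h].
    by rewrite mulr0; exact: dot_ge0 preS _ Vu.
  move=> h2; rewrite -(ler_pM2r d0); apply: le_trans h2.
  rewrite -mulrA -expr2 -exprMn ler_sqr ?nnegrE //.
    by rewrite mulr_ge0 // ltW.
  by apply: le_trans h; rewrite mulr_ge0 // ltW.
have cS : sqcomplete V S.
  move=> x Vx cx; have [|l Vl hl] := cV _ Vx.
    move=> e e0; have [N hN] := cx _ (mulr_gt0 (exprn_gt0 2 c0) e0).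
    exists N => m n hm hn; have := hN _ _ hm hn.
    have := geS _ (subspaceB H (Vx m) (Vx n)) => h1 h2.
    by have := le_lt_trans h1 h2; rewrite ltr_pM2l // exprn_gt0.
  exists l => // e e0; have C1 : 0 < C + 1 by rewrite ltr_wpDl.
  have [N hN] := hl _ (divr_gt0 e0 C1); exists N => n hn.
  have := hN _ hn; rewrite ltr_pdivlMr // mulrDr mulr1 => h.
  have Vd := subspaceB H (Vx n) Vl.
  apply: le_lt_trans (leS _ Vd) _; rewrite mulrC.
  by apply: le_lt_trans h; rewrite lerDl (dot_ge0 H).
have [f Vf hf] := riesz H C0 cV lF FC.
have lG : linear_on V (fun v => dot f (A v)).
  move=> a u v Vu Vv; have Vuv := prehilbertDZ H a Vu Vv.
  rewrite !(dotC H Vf); try exact: VA.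
  by rewrite !dotA ?lBl.
have GC v : V v -> dot f (A v) ^+ 2 <= dot f f * S v v.
  by move=> Vv; have := cauchy_schwarz H Vf (VA _ Vv).
have [u Vu hu] := riesz preS (dot_ge0 H Vf) cS lG GC.
pose r := A u - f; have Vr : V r by apply: (subspaceB H) => //; exact: VA.
have r0 v : V v -> B v r = 0.
  move=> Vv; have VAu := VA _ Vu; have VAv := VA _ Vv.
  rewrite -dotA // (dotC H) // /r (linear_onB H (linear_dotl H VAv)) //.
  by rewrite -/(S u v) hu // subrr.
have rr0 : dot r r = 0.
  apply/eqP; rewrite eq_le (dot_ge0 H) // andbT -(pmulr_rle0 _ c0).
  by rewrite -(r0 _ Vr); exact: Bc.
exists u => // v Vv; have VAu := VA _ Vu; rewrite -hf // -dotA //.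
apply/eqP; rewrite -subr_eq0 -(linear_onB H (linear_dotl H Vv)) // -/r.
rewrite -sqrf_eq0 eq_le sqr_ge0 andbT.
by have := cauchy_schwarz H Vr Vv; rewrite rr0 mul0r.
Qed.

End semi_inner_product.

(** * Products and closed subspaces of semidefinite inner product spaces *)

Section product.
Context {R : realType} {W1 W2 : lmodType R}.
Variables (V1 : W1 -> Prop) (dot1 : W1 -> W1 -> R).
Variables (V2 : W2 -> Prop) (dot2 : W2 -> W2 -> R).
Hypotheses (H1 : prehilbert V1 dot1) (H2 : prehilbert V2 dot2).

Definition prod_sub (w : W1 * W2) := V1 w.1 /\ V2 w.2.
Definition prod_dot (v w : W1 * W2) := dot1 v.1 w.1 + dot2 v.2 w.2.

Lemma prehilbert_prod : prehilbert prod_sub prod_dot.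
Proof.
split.
- by split; [exact: prehilbert0 H1|exact: prehilbert0 H2].
- by move=> a u v [u1 u2] [v1 v2]; split;
    [exact: prehilbertDZ H1 _ _ _ u1 v1|exact: prehilbertDZ H2 _ _ _ u2 v2].
- by move=> u v [u1 u2] [v1 v2]; rewrite /prod_dot (dotC H1) // (dotC H2).
- move=> a u v w [u1 u2] [v1 v2] [w1 w2].
  by rewrite /prod_dot /= (dotDZl H1) // (dotDZl H2) //; ring.
- by move=> u [u1 u2]; rewrite addr_ge0 // ?(dot_ge0 H1) ?(dot_ge0 H2).
Qed.

Lemma sqcomplete_prod : sqcomplete V1 dot1 -> sqcomplete V2 dot2 ->
  sqcomplete prod_sub prod_dot.
Proof.
move=> c1 c2 u Vu cu.
have V1u n : V1 (u n).1 by exact: (Vu n).1.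
have V2u n : V2 (u n).2 by exact: (Vu n).2.
have [|l1 Vl1 h1] := c1 _ V1u.
  move=> e /cu[N hN]; exists N => m n hm hn; apply: le_lt_trans (hN m n hm hn).
  by rewrite lerDl (dot_ge0 H2) //; have := subspaceB H2 (V2u m) (V2u n).
have [|l2 Vl2 h2] := c2 _ V2u.
  move=> e /cu[N hN]; exists N => m n hm hn; apply: le_lt_trans (hN m n hm hn).
  by rewrite lerDr (dot_ge0 H1) //; have := subspaceB H1 (V1u m) (V1u n).
exists (l1, l2) => // e e0; have e2 : 0 < e / 2 by rewrite divr_gt0.
have [N1 hN1] := h1 _ e2; have [N2 hN2] := h2 _ e2.
exists (maxn N1 N2) => n; rewrite geq_max => /andP[n1 n2].
by rewrite (splitr e) ltrD //; [exact: hN1|exact: hN2].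
Qed.
End product.

Section closed_subspaces.
Context {R : realType} {W : lmodType R}.
Variables (V : W -> Prop) (dot : W -> W -> R).
Hypothesis H : prehilbert V dot.

Lemma prehilbert_sub (V' : W -> Prop) : (forall u, V' u -> V u) -> V' 0 ->
  (forall a u v, V' u -> V' v -> V' (a *: u + v)) -> prehilbert V' dot.
Proof.
move=> V'V V'0 V'D; split => //.
- by move=> u v /V'V Vu /V'V Vv; exact: dotC H _ _ Vu Vv.
- by move=> a u v w /V'V Vu /V'V Vv /V'V Vw; exact: dotDZl H _ _ _ _ Vu Vv Vw.
- by move=> u /V'V Vu; exact: dot_ge0 H _ Vu.
Qed.

Lemma sqcomplete_sub (V' : W -> Prop) : (forall u, V' u -> V u) ->
  (forall u l, (forall n, V' (u n)) -> V l -> sqcvg dot u l -> V' l) ->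
  sqcomplete V dot -> sqcomplete V' dot.
Proof.
move=> V'V V'cl cV u V'u cu; have [|l Vl ul] := cV u _ cu.
  by move=> n; exact: V'V.
by exists l => //; exact: V'cl V'u Vl ul.
Qed.

(** By Cauchy-Schwarz, [dot l g] is controlled by the distance from [u n] to [l]. This is what
    carries weak gradients to limits. *)
Lemma dot_eq0_closed u l g : (forall n, V (u n)) -> V l -> V g ->
  sqcvg dot u l -> (forall n, dot (u n) g = 0) -> dot l g = 0.
Proof.
move=> Vu Vl Vg ul u0.
apply: (sqr_le_eps_eq0 (dot_ge0 H Vg)) => e /ul[N /(_ _ (leqnn N)) h].
have := cauchy_schwarz H (subspaceB H (Vu N) Vl) Vg.
rewrite (linear_onB H (linear_dotl H Vg)) // u0 sub0r sqrrN => /le_trans; apply.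
by rewrite ler_wpM2r ?(dot_ge0 H) // ltW.
Qed.

(** Expansion of t times the square of u - t^-1 v. The free weight t lets the stability estimate
    absorb the part of a product that involves the solution. *)
Lemma young (t : R) u v : 0 < t -> V u -> V v ->
  2 * dot u v <= t * dot u u + t^-1 * dot v v.
Proof.
move=> t0 Vu Vv.
have Vw : V (u + (- t^-1) *: v) by apply: (subspaceD H) => //; exact: (subspaceZ H).
have := mulr_ge0 (ltW t0) (dot_ge0 H Vw); rewrite (dot_sqrDZ H) //.
have -> : t * (dot u u + - t^-1 * dot u v *+ 2 + (- t^-1) ^+ 2 * dot v v) =
  t * dot u u + t^-1 * dot v v - 2 * dot u v by field; rewrite gt_eqF.
by rewrite subr_ge0.
Qed.

Lemma youngN (t : R) u v : 0 < t -> V u -> V v ->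
  - (2 * dot u v) <= t * dot u u + t^-1 * dot v v.
Proof.
move=> t0 Vu Vv; have VN := subspaceZ H (-1) Vv.
have := young t0 Vu VN.
rewrite !(linear_onZ H _ (linear_dotr H _)) //.
rewrite (linear_onZ H _ (linear_dotl H Vv)) //; lra.
Qed.
End closed_subspaces.

(** * L^2 and its completeness *)

Section L2_space.
Context (R : realType) (d : nat) (Omega : set 'rV[R]_d).
Hypothesis mO : measurable Omega.
Local Notation E := 'rV[R]_d.
Local Notation mu := (lebesgue_rV R d).
Local Notation L2 := (L2 Omega).
Local Notation dot := (L2dot Omega).
Implicit Types f g h : E -> R.

Lemma L2_measurable f : L2 f -> measurable_fun Omega f.
Proof.
move=> /andP[/= mf _]; apply/measurable_restrictT => //.
by move: mf; rewrite inE.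
Qed.

Lemma L2_mul_integrable f g : L2 f -> L2 g ->
  mu.-integrable Omega (EFin \o (fun x => f x * g x)).
Proof.
move=> Lf Lg; apply/integrable_mkcond => //.
have /Lfun1_integrable := Lfun2_mul_Lfun1 Lf Lg.
apply: eq_integrable => // x _; rewrite /= !patchE.
by case: ifPn => //; rewrite mulr0.
Qed.

(** Finiteness is stated with the extended real integral, because [dot f f] is a [fine] value and
    would read an infinite integral as 0. *)
Lemma L2P f : L2 f <->
  measurable_fun Omega f /\ (\int[mu]_(x in Omega) (f x * f x)%:E < +oo)%E.
Proof.
split=> [Lf|[mf If]].
  split; first exact: L2_measurable.
  have := L2_mul_integrable Lf Lf; move=> /integrableP[_].
  by under eq_integral do rewrite /= ger0_norm ?sqr_ge0 //.
apply/andP; split; rewrite /= inE /=.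
  exact: (measurable_restrictT f mO).1 mf.
rewrite /finite_norm unlock; apply: poweR_lty.
rewrite [X in (X < _)%E](_ : _ = \int[mu]_(x in Omega) (f x * f x)%:E)%E //.
rewrite [RHS]integral_mkcond; apply: eq_integral => x _.
rewrite /= !patchE; case: ifPn => _; last by rewrite normr0 powR0.
by rewrite powR_mulrn // real_normK ?num_real // expr2.
Qed.

Lemma L2dotE f : L2 f ->
  (\int[mu]_(x in Omega) (f x * f x)%:E = (dot f f)%:E)%E.
Proof.
by move=> Lf; rewrite /L2dot /Rintegral fineK // integrable_fin_num // L2_mul_integrable.
Qed.

Lemma prehilbert_L2 : prehilbert L2 dot.
Proof.
split.
- apply/L2P; split; first exact: measurable_cst.
  by rewrite (eq_integral (cst 0%E)) ?integral0 // => x _; rewrite mulr0.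
- move=> a u v Lu Lv; rewrite /Defs.L2.
  have -> : (a *: u + v) \_ Omega = a *: (u \_ Omega) + v \_ Omega.
    apply/funext => x; rewrite !fctE !patchE; case: ifPn => // _.
    by rewrite /GRing.scale /= mulr0 addr0.
  have one_le2 : (1 <= 2%:E :> \bar R)%E by rewrite lee1n.
  by have [_] := Lfun_submod_closed mu one_le2; apply.
- by move=> u v _ _; apply: eq_Rintegral => x _; rewrite mulrC.
- move=> a u v w Lu Lv Lw.
  have iu := L2_mul_integrable Lu Lw; have iv := L2_mul_integrable Lv Lw.
  rewrite /L2dot -RintegralZl // -RintegralD //; last exact: integrableZl iu.
  by apply: eq_Rintegral => x _; rewrite !fctE mulrDl mulrA.
- by move=> u _; apply: Rintegral_ge0 => x _; rewrite -expr2 sqr_ge0.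
Qed.

Lemma L2dot_eq0 f : L2 f -> dot f f = 0 -> ae_eq mu Omega f (cst 0).
Proof.
move=> Lf f0; have mf := L2_measurable Lf.
have mff : measurable_fun Omega (fun x => (f x * f x)%:E).
  by apply/measurable_EFinP; exact: measurable_funM.
have /(ae_eq_integral_abs mu mO mff) : (\int[mu]_(x in Omega) `|(f x * f x)%:E| = 0)%E.
  under eq_integral do rewrite gee0_abs ?lee_fin -?expr2 ?sqr_ge0 //.
  by under eq_integral do rewrite expr2; rewrite L2dotE // f0.
apply: filterS => x h Ox; have := h Ox => -[] /eqP.
by rewrite mulf_eq0 orbb => /eqP.
Qed.

End L2_space.

(** * Riesz-Fischer theorem for scalar functions *)

Section riesz_fischer.
Context (R : realType) (d : nat) (Omega : set 'rV[R]_d).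
Hypothesis mO : measurable Omega.
Local Notation E := 'rV[R]_d.
Local Notation mu := (lebesgue_rV R d).
Local Notation L2 := (L2 Omega).
Local Notation dot := (L2dot Omega).

Lemma sum_halves (n : nat) : \sum_(0 <= k < n) 2^-1 ^+ k <= 2 :> R.
Proof.
suff -> : \sum_(0 <= k < n) 2^-1 ^+ k = 2 - 2 * 2^-1 ^+ n :> R.
  by rewrite gerBl mulr_ge0 // exprn_ge0 // invr_ge0.
elim: n => [|n IHn]; first by rewrite big_nil expr0; lra.
by rewrite big_nat_recr //= IHn exprS; field.
Qed.

Lemma norm_le_weighted_sqr (x p q : R) : 0 < p -> p * q = 1 ->
  `|x| <= p * x ^+ 2 + q.
Proof.
move=> p0 pq.
have : 0 <= p * (`|x| - q) ^+ 2 by rewrite mulr_ge0 ?sqr_ge0 // ltW.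
have -> : p * (`|x| - q) ^+ 2 =
  p * `|x| ^+ 2 - 2 * `|x| * (p * q) + (p * q) * q by ring.
rewrite pq real_normK ?num_real //; have := normr_ge0 x; lra.
Qed.

(** Each increment is at most 2^k times its square plus 2^-k, so the increments are absolutely
    summable. Only squares occur in the hypothesis, which is what an L^2 bound can be integrated
    into directly. *)
Lemma cvg_of_weighted_squares (w : nat -> R) (C : R) :
  (forall n, \sum_(0 <= k < n) 2 ^+ k * (w k.+1 - w k) ^+ 2 <= C) ->
  cvgn w.
Proof.
move=> hC.
have cs : cvgn (series (telescope w)).
  apply: normed_cvg; apply: nondecreasing_is_cvgn.
    by apply: nondecreasing_series => *; exact: normr_ge0.
  exists (C + 2) => _ [n _ <-]; rewrite /series /=.
  apply: le_trans (lerD (hC n) (sum_halves n)).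
  rewrite -big_split /=; apply: ler_sum => k _; rewrite /telescope.
  have p0 : 0 < 2 ^+ k :> R by rewrite exprn_gt0.
  by apply: norm_le_weighted_sqr => //; rewrite -exprMn mulfV // expr1n.
have -> : w = cst (w 0) \+ series (telescope w).
  by apply/funext => n; rewrite /= -eq_sum_telescope.
exact: is_cvgD (is_cvg_cst (w 0)) cs.
Qed.

Lemma limn_einf_le (u : (\bar R)^nat) (c : \bar R) (N : nat) :
  (forall k, (N <= k)%N -> (u k <= c)%E) -> (limn_einf u <= c)%E.
Proof.
move=> h; rewrite limn_einf_lim; apply: lime_le; first exact: is_cvg_einfs.
near=> n; apply: le_trans (h n _); last by near: n; exact: nbhs_infty_ge.
by apply: ereal_inf_lbound; exists n => /=.
Unshelve. all: by end_near. Qed.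

(** Fatou's lemma applied to the squares. It will be used on differences with a fixed term of a
    Cauchy sequence, where it yields membership and smallness at once. *)
Lemma L2_fatou (g : nat -> E -> R) (f : E -> R) (c : R) (N : nat) :
  (forall k, L2 (g k)) -> measurable_fun Omega f ->
  (forall k, (N <= k)%N -> dot (g k) (g k) <= c) ->
  (forall x, Omega x -> (fun k => g k x) @ \oo --> f x) ->
  L2 f /\ dot f f <= c.
Proof.
move=> Lg mf gc gf.
have If : (\int[mu]_(x in Omega) (f x * f x)%:E <= c%:E)%E.
  rewrite (eq_integral (fun x => limn_einf (fun k => (g k x * g k x)%:E))).
    apply: le_trans (fatou mu mO _ _) _ => //=.
    - move=> k; apply/measurable_EFinP.
      by apply: measurable_funM; exact: L2_measurable.
    - by move=> k x _; rewrite lee_fin -expr2 sqr_ge0.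
    - apply: (@limn_einf_le _ _ N) => k /gc.
      by rewrite -lee_fin -L2dotE.
  move=> x; rewrite inE => Ox; apply/esym.
  apply: (cvg_limn_einf_sup _).1; apply: cvg_EFin; first exact: nearW.
  by apply: cvgM; exact: gf.
have Lf : L2 f by apply/L2P => //; split => //; exact: le_lt_trans If (ltry _).
by split => //; rewrite -lee_fin -L2dotE.
Qed.

Lemma L2_ae_eq (f g : E -> R) : L2 f -> measurable_fun Omega g ->
  ae_eq mu Omega g f -> L2 g /\ dot g g = dot f f.
Proof.
move=> Lf mg fg.
have gf : (\int[mu]_(x in Omega) (g x * g x)%:E =
           \int[mu]_(x in Omega) (f x * f x)%:E)%E.
  apply: ae_eq_integral => //.
  - by apply/measurable_EFinP; exact: measurable_funM.
  - by apply/measurable_EFinP; apply: measurable_funM; exact: L2_measurable.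
  - by apply: filterS fg => x h Ox; rewrite (h Ox).
split; last by rewrite /L2dot /Rintegral gf.
by apply/L2P => //; split => //; rewrite gf; have /(L2P mO)[] := Lf.
Qed.

(* Along a subsequence [v] with squared increments below [4^-k], the series of
   [2^k (v_(k+1) - v_k)^2] has a finite integral, hence is finite a.e.; there [v]
   converges by [cvg_of_weighted_squares]. *)
Lemma sqcomplete_L2 : sqcomplete L2 dot.
Proof.
move=> u Lu cu; have H := prehilbert_L2 mO.
have geo0 k : 0 < 4^-1 ^+ k :> R by rewrite exprn_gt0.
have [N hN] := choice (fun k => cu _ (geo0 k)).
(* The sum makes [s] nondecreasing with [s k] at least [N k]; the summand [k] makes it tend to
   infinity. *)
pose s k := (k + \sum_(j < k.+1) N j)%N.
have sS k : (s k <= s k.+1)%N by rewrite /s leq_add // [leqRHS]big_ord_recr leq_addr.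
have Ns k : (N k <= s k)%N by rewrite /s big_ord_recr /= addnA leq_addl.
pose v k := u (s k); pose D k := v k.+1 - v k.
have Lv k : L2 (v k) by exact: Lu.
have LD k : L2 (D k) by have := subspaceB H (Lv k.+1) (Lv k).
have dotD k : dot (D k) (D k) < 4^-1 ^+ k.
  by apply: hN; [exact: leq_trans (Ns k) (sS k)|exact: Ns].
pose T (k : nat) x := (2 ^+ k * (D k x * D k x))%:E.
have T0 k x : (0 <= T k x)%E by rewrite lee_fin mulr_ge0 ?exprn_ge0 // -expr2 sqr_ge0.
have mT k : measurable_fun Omega (T k).
  apply/measurable_EFinP; apply: measurable_funM; first exact: measurable_cst.
  by apply: measurable_funM; exact: L2_measurable.
pose S x := (\sum_(0 <= k <oo) T k x)%E.
have mS : measurable_fun Omega S by exact: ge0_emeasurable_sum.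
have IS : (\int[mu]_(x in Omega) S x < +oo)%E.
  rewrite integral_nneseries //; apply: (@le_lt_trans _ _ 2%:E); last exact: ltry.
  apply: lime_le; first by apply: is_cvg_nneseries => k _ _; exact: integral_ge0.
  apply: nearW => n; apply: (@le_trans _ _ (\sum_(0 <= k < n) 2^-1 ^+ k)%:E); last first.
    by rewrite lee_fin sum_halves.
  rewrite -sumEFin; apply: lee_sum => k _.
  under eq_integral do rewrite /T EFinM.
  rewrite integralZl //; last exact: L2_mul_integrable.
  rewrite L2dotE // -EFinM lee_fin (@le_trans _ _ (2 ^+ k * 4^-1 ^+ k)) //.
    by rewrite ler_wpM2l ?exprn_ge0 // ltW.
  rewrite -exprMn (_ : 2 * 4^-1 = 2^-1) //; by field.
have aeS : {ae mu, forall x, Omega x -> S x \is a fin_num}.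
  apply: integrable_ae => //; apply/integrableP; split => //.
  under eq_integral do rewrite gee0_abs ?nneseries_ge0 //.
  exact: IS.
pose A := Omega `&` [set x | S x < +oo]%E.
have mA : measurable A by exact: emeasurable_fun_infty_o.
(* Cutting [v k] off to 0 where the series diverges gives convergence at every point of [Omega],
   hence a measurable limit; since the cut happens on a null set, no norm changes. *)
pose h k x := v k x * \1_A x; pose f x := limn (h^~ x).
have hvE k x : A x -> h k x = v k x.
  by move=> Ax; rewrite /h indicE mem_set // mulr1.
have hf x : Omega x -> h^~ x @ \oo --> f x.
  move=> Ox; have [Sx|nSx] := ltP (S x) +oo%E; last first.
    suff h0 : h^~ x = cst 0 by rewrite /f h0; exact: is_cvg_cst.
    apply/funext => k; rewrite /h indicE memNset ?mulr0 // => -[_ /=].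
    by rewrite ltNge nSx.
  have Ax : A x by [].
  apply: (@cvg_of_weighted_squares _ (fine (S x))) => n.
  rewrite -lee_fin fineK; last by rewrite ge0_fin_numE // nneseries_ge0.
  rewrite -sumEFin /S; apply: le_trans (nneseries_lim_ge n _) => //.
  by apply: lee_sum => k _; rewrite !hvE // /T expr2.
have mh k : measurable_fun Omega (h k).
  have mv := L2_measurable mO (Lv k).
  exact: measurable_funM mv (measurable_indic mA).
have mf : measurable_fun Omega f by exact: measurable_fun_cvg mh hf.
have udot n k : L2 (u n - h k) /\
    dot (u n - h k) (u n - h k) = dot (u n - v k) (u n - v k).
  apply: L2_ae_eq.
  - by have := subspaceB H (Lu n) (Lv k).
  - by apply: measurable_funB => //; exact: L2_measurable.
  - apply: filterS aeS => x Sx Ox; rewrite !fctE hvE //; split => //.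
    by rewrite /= ltey_eq Sx.
have key (e : R) : 0 < e -> exists N, forall n, (N <= n)%N ->
    L2 (u n - f) /\ dot (u n - f) (u n - f) < e.
  move=> e0; have e2 : 0 < e / 2 by rewrite divr_gt0.
  have [K hK] := cu _ e2; exists K => n Kn.
  have [] := @L2_fatou (fun k => u n - h k) (u n - f) (e / 2) K.
  - by move=> k; exact: (udot n k).1.
  - by apply: measurable_funB => //; exact: L2_measurable.
  - move=> k Kk; rewrite (udot n k).2; apply/ltW/hK => //.
    by apply: leq_trans Kk _; exact: leq_addr.
  - by move=> x Ox; apply: cvgB; [exact: cvg_cst|exact: hf].
  move=> Ld hd; split => //; apply: le_lt_trans hd _.
  by rewrite ltr_pdivrMr // ltr_pMr // ltr1n.
exists f.
  have [K hK] := key 1 ltr01; have [Ld _] := hK K (leqnn _).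
  have := subspaceB H (Lu K) Ld.
  by rewrite opprB addrC subrK.
by move=> e e0; have [K hK] := key e e0; exists K => n /hK[].
Qed.

End riesz_fischer.

(** * Vector-valued L^2, coordinate by coordinate *)

Section L2v_space.
Context (R : realType) (d : nat) (Omega : set 'rV[R]_d).
Hypothesis mO : measurable Omega.
Local Notation E := 'rV[R]_d.
Local Notation mu := (lebesgue_rV R d).
Local Notation L2 := (L2 Omega).
Local Notation dot := (L2dot Omega).
Local Notation L2v := (L2v Omega).
Local Notation dotv := (L2dotv Omega).
Implicit Types F G : E -> E.
Let coord (i : 'I_d) F := fun x => F x 0 i.

Lemma L2dotvE F G : L2v F -> L2v G -> dotv F G = \sum_i dot (coord i F) (coord i G).
Proof.
move=> LF LG; rewrite /L2dotv /L2dot.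
(* Integrability of the partial sums is carried through the induction, as additivity of the integral
   asks for it. *)
suff sumE (s : seq 'I_d) :
    mu.-integrable Omega (EFin \o (fun x => \sum_(i <- s) F x 0 i * G x 0 i)) /\
    \int[mu]_(x in Omega) (\sum_(i <- s) F x 0 i * G x 0 i) =
    \sum_(i <- s) \int[mu]_(x in Omega) (F x 0 i * G x 0 i) by exact: (sumE _).2.
have iFG i : mu.-integrable Omega (EFin \o (fun x => F x 0 i * G x 0 i)).
  exact: L2_mul_integrable (LF i) (LG i).
elim: s => [|i s [is_ IHs]].
  have E0 : (fun x => \sum_(i <- [::]) F x 0 i * G x 0 i) = cst 0.
    by apply/funext => x; rewrite big_nil.
  rewrite E0 big_nil; split; first exact: integrable0.
  by rewrite /Rintegral integral0.
have E1 : (fun x => \sum_(j <- i :: s) F x 0 j * G x 0 j) =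
    (fun x => F x 0 i * G x 0 i + \sum_(j <- s) F x 0 j * G x 0 j).
  by apply/funext => x; rewrite big_cons.
rewrite E1; split; last by rewrite RintegralD // IHs big_cons.
by have := integrableD mO (iFG i) is_.
Qed.

Let coordDZ i a F G : coord i (a *: F + G) = a *: coord i F + coord i G.
Proof. by apply/funext => x; rewrite /coord !fctE !mxE. Qed.

Lemma prehilbert_L2v : prehilbert L2v dotv.
Proof.
have H := prehilbert_L2 mO.
have L2vDZ a F G : L2v F -> L2v G -> L2v (a *: F + G).
  move=> LF LG i; rewrite -/(coord i _) coordDZ.
  by have := prehilbertDZ H a (LF i) (LG i).
split.
- move=> i; have := prehilbert0 H; congr Defs.L2.
  by apply/funext => x; rewrite mxE.
- exact: L2vDZ.
- move=> F G LF LG; rewrite !L2dotvE //; apply: eq_bigr => i _.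
  by have := dotC H (LF i) (LG i).
- move=> a F G K LF LG LK; rewrite !L2dotvE //; last exact: L2vDZ.
  rewrite mulr_sumr -big_split; apply: eq_bigr => i _.
  by rewrite coordDZ; have := dotDZl H a (LF i) (LG i) (LK i).
- move=> F LF; rewrite L2dotvE //; apply: sumr_ge0 => i _.
  by have := dot_ge0 H (LF i).
Qed.

Lemma coord_le_L2dotv F i : L2v F -> dot (coord i F) (coord i F) <= dotv F F.
Proof.
move=> LF; rewrite L2dotvE // (bigD1 i) //= lerDl; apply: sumr_ge0 => j _.
by have := dot_ge0 (prehilbert_L2 mO) (LF j).
Qed.

Lemma sqcomplete_L2v : sqcomplete L2v dotv.
Proof.
move=> u Lu cu; have H := prehilbert_L2 mO; have Hv := prehilbert_L2v.
have coordB i F G : coord i (F - G) = coord i F - coord i G.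
  by apply/funext => x; rewrite /coord !fctE !mxE.
have LB m n : L2v (u m - u n) by have := subspaceB Hv (Lu m) (Lu n).
have /choice[l hl] : forall i, exists l,
    L2 l /\ sqcvg dot (fun n => coord i (u n)) l.
  move=> i; have [||g] := sqcomplete_L2 mO (u := fun n => coord i (u n)).
  - by move=> n; exact: Lu.
  - move=> e /cu[N hN]; exists N => m n hm hn; rewrite -coordB.
    by apply: le_lt_trans (hN m n hm hn); exact: coord_le_L2dotv.
  by exists g.
pose F : E -> E := fun x => \row_i l i x.
have FE i : coord i F = l i by apply/funext => x; rewrite /coord mxE.
have LF : L2v F by move=> i; rewrite -/(coord i F) FE; exact: (hl i).1.
(* The d coordinates contribute at most d e / (d + 1), which is strictly below e even for d = 0. *)
exists F => // e e0; have d0 : 0 < d.+1%:R :> R by [].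
have [N hN] := choice (fun i => (hl i).2 _ (divr_gt0 e0 d0)).
exists (\max_i N i)%N => n hn.
have LuF : L2v (u n - F) by have := subspaceB Hv (Lu n) LF.
rewrite L2dotvE //; apply: (@le_lt_trans _ _ (\sum_(i < d) (e / d.+1%:R))).
  apply: ler_sum => i _; rewrite coordB FE; apply/ltW/hN.
  by apply: leq_trans hn; exact: leq_bigmax.
rewrite sumr_const card_ord -[_ *+ d]mulr_natr mulrAC ltr_pdivrMr //.
by rewrite ltr_pM2l // ltr_nat.
Qed.

End L2v_space.

(** * Borel sets and integration on row vectors *)

Section rV_borel.
Context (R : realType) (n : nat).
Implicit Types (x y : 'rV[R]_n) (A : set 'rV[R]_n).

Lemma rV_ballP x e y : 0 < e -> ball x e y <-> forall i, `|x 0 i - y 0 i| < e.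
Proof.
move=> e0; split=> [[_ h] i|h]; first exact: h 0 i.
by split=> // i j; rewrite ord1; exact: h.
Qed.

Lemma measurable_rV_ball x e : 0 < e -> measurable (ball x e).
Proof.
move=> e0.
rewrite (_ : ball x e = \bigcap_(i in [set: 'I_n])
    ((fun y : 'rV[R]_n => y 0 i : measurableTypeR R) @^-1` ball (x 0 i) e)).
  apply: fin_bigcap_measurable => // i _; rewrite -[X in measurable X]setTI.
  apply: measurable_coord => //; apply: open_measurable; exact: ball_open.
apply/seteqP; split => y; first by move=> /rV_ballP h i _; exact: h.
by move=> h; apply/rV_ballP => // i; exact: h.
Qed.

(** The sigma-algebra is generated by coordinates, so this needs second countability: an open set is
    the union of the balls it contains with rational centre and radius 1/(k+1), and a ball is a
    finite intersection of coordinate strips. *)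
Lemma open_measurable_rV A : open A -> measurable A.
Proof.
move=> oA.
pose c (q : 'rV[rat]_n) : 'rV[R]_n := map_mx ratr q.
pose F (p : 'rV[rat]_n * nat) : set 'rV[R]_n :=
  if `[< ball (c p.1) p.2.+1%:R^-1 `<=` A >]
  then ball (c p.1) p.2.+1%:R^-1 else set0.
have -> : A = \bigcup_p F p.
  apply/seteqP; split => [x Ax|x [p _]]; last first.
    by rewrite /F; case: asboolP => // h; exact: h.
  have /nbhs_ballP[e /= e0 xe] : nbhs x A by exact: open_nbhs_nbhs.
  have [k _ hk] := near_infty_natSinv_lt (PosNum (divr_gt0 e0 (ltr0n _ 2))).
  have k0 : 0 < k.+1%:R^-1 :> R by rewrite invr_gt0.
  have exq i : exists q : rat, `|ratr q - x 0 i| < k.+1%:R^-1.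
    have [|q] := @rat_in_itvoo R (x 0 i - k.+1%:R^-1) (x 0 i + k.+1%:R^-1).
      by rewrite ltrBlDr -addrA ltrDl addr_gt0.
    by rewrite in_itv/= => /andP[h1 h2]; exists q; rewrite ltr_distl h1 h2.
  have [q hq] := choice exq.
  exists (\row_i q i, k) => //; rewrite /F /=; case: asboolP => [_|[]].
    by apply/rV_ballP => // i; rewrite !mxE.
  move=> y /(rV_ballP _ _ k0) hy; apply: xe; apply/rV_ballP => // i.
  have := hq i; have := hy i; rewrite !mxE => h1 h2.
  have /= h3 := hk k (leqnn _).
  rewrite (le_lt_trans (ler_distD (ratr (q i)) _ _)) // distrC.
  by rewrite (splitr e) ltrD // (lt_trans _ h3).
apply: countable_bigcupT_measurable; first exact: countableP.
move=> p; rewrite /F; case: ifP => _ //.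
by apply: measurable_rV_ball; rewrite invr_gt0.
Qed.

Lemma continuous_measurable_rV (f : 'rV[R]_n -> R) :
  continuous f -> measurable_fun setT (f : _ -> measurableTypeR R).
Proof.
move=> cf; apply: (measurability _ (RGenOpens.measurableE R)).
move=> _ [_ [a [b ->] <-]]; rewrite setTI; apply: open_measurable_rV.
by apply: open_comp => [x _|]; [exact: cf|exact: interval_open].
Qed.

Lemma bounded_rV_coord A : bounded_set A ->
  exists2 M : R, 0 < M & forall x, A x -> forall i, `|x 0 i| <= M.
Proof.
move=> [M [Mr hM]]; exists (`|M| + 1); first by rewrite ltr_pwDr.
have ltM : M < `|M| + 1 by rewrite (le_lt_trans (ler_norm M)) // ltrDl.
move=> x Ax i; have := hM _ ltM x Ax.
apply: le_trans; rewrite [leRHS]/Num.norm /= mx_normrE.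
by apply/bigmax_geP; right; exists (0, i).
Qed.

End rV_borel.

(** * Integrals of derivatives on the line *)

Section line.
Context (R : realType).

Lemma derive_outside (G g : R -> R) (M : R) :
  (forall t : R, is_derive t 1 G (g t)) -> (forall t, M < `|t| -> G t = 0) ->
  forall t, M < `|t| -> g t = 0.
Proof.
move=> dG G0 t Mt; have dGt := dG t.
rewrite -[g t](@derive_val _ _ _ t 1 G (g t) (dG t)).
rewrite (@near_eq_derive _ _ _ _ (cst 0)) ?derive_cst //.
have : \forall s \near t, M < `|s|.
  exact: cvgr_gt `|t| (@norm_continuous R R t) _ Mt.
by apply: filterS => s; exact: G0.
Qed.

Lemma integral_derive_compact (G g : R -> R) (M : R) : 0 < M ->
  (forall t : R, is_derive t 1 G (g t)) -> continuous g ->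
  (forall t, M < `|t| -> G t = 0) ->
  (\int[lebesgue_measure]_t (g t)%:E = 0)%E.
Proof.
move=> M0 dG cg G0; have g0 := derive_outside dG G0.
(* The margin 1 puts the endpoints in the region where [G] is known to vanish. *)
have -> : (fun t => (g t)%:E) = (EFin \o g) \_ `[- (M + 1), M + 1].
  apply/funext => t; rewrite patchE; case: ifPn => //= /negP ht.
  rewrite g0 // ltNge; apply/negP => h; apply: ht; rewrite inE /= in_itv /=.
  by move: h; rewrite ler_norml => /andP[]; lra.
rewrite -integral_mkcond.
rewrite (@continuous_FTC2 _ _ G) ?G0 ?subee //.
- by rewrite normrN ger0_norm; lra.
- by rewrite ger0_norm; lra.
- lra.
- exact: continuous_subspaceT.
- have cG t : {for t, continuous G}.
    by apply: differentiable_continuous; apply/derivable1_diffP; exact: ex_derive.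
  split => [t _||]; first exact: ex_derive.
    by apply: cvg_at_right_filter; exact: cG.
  by apply: cvg_at_left_filter; exact: cG.
- by move=> t _; rewrite derive1E; exact: derive_val.
Qed.

End line.

Definition rV_box (R : realType) n (M : R) :=
  [set x : 'rV[R]_n | forall i, `|x 0 i| <= M].
Arguments rV_box {R} n M.

Section lebesgue_rV_support.
Context (R : realType).
Local Notation mu n := (lebesgue_rV R n).

Lemma measurable_rV_box n (M : R) : measurable (rV_box n M).
Proof.
rewrite (_ : rV_box n M = \bigcap_(i in [set: 'I_n])
    ((fun x : 'rV[R]_n => x 0 i : measurableTypeR R) @^-1` `[- M, M])).
  apply: fin_bigcap_measurable => // i _; rewrite -[X in measurable X]setTI.
  by apply: measurable_coord => //; exact: measurable_itv.
apply/seteqP; split => x h i; first by move=> _ /=; rewrite in_itv/= -ler_norml.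
by have := h i I; rewrite /= in_itv/= -ler_norml.
Qed.

(** Induction along the recursive construction of the measure: [cons_rV] pulls a box back to an
    interval times a smaller box. *)
Lemma lebesgue_rV_box_lty n (M : R) : (mu n (rV_box n M) < +oo)%E.
Proof.
elim: n => [|n IHn] /=; first by rewrite diracE ltry.
rewrite /lebesgue_rVS /pushforward.
have -> : @cons_rV R n @^-1` rV_box n.+1 M = `[- M, M]%classic `*` rV_box n M.
  apply/seteqP; split => -[t y] /=.
    move=> h; split => [|i]; last by have := h (lift 0 i); rewrite cons_rVS.
    by have := h 0; rewrite cons_rV0 in_itv/= -ler_norml.
  rewrite in_itv/= -ler_norml => -[ht hy] i.
  by case: (unliftP 0 i) => [j|] ->; rewrite ?cons_rV0 ?cons_rVS.
rewrite product_measure1E //; last exact: measurable_rV_box.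
apply: lte_mul_pinfty => //; rewrite ge0_fin_numE //.
rewrite /= lebesgue_measure_itv.
by case: ifP => // _; rewrite -EFinB ltry.
Qed.

Lemma integrable_bounded_support n (f : 'rV[R]_n -> R) (M C : R) :
  measurable_fun setT f -> (forall x, `|f x| <= C) ->
  (forall x, ~ rV_box n M x -> f x = 0) ->
  (mu n).-integrable setT (EFin \o f).
Proof.
move=> mf fC f0; have C0 : 0 <= C by exact: le_trans (normr_ge0 _) (fC 0).
apply: (@le_integrable _ _ _ _ _ _ _ (EFin \o (C \o* \1_(rV_box n M)))) => //.
- exact/measurable_EFinP.
- move=> x _ /=; rewrite lee_fin indicE.
  have [Bx|nBx] := pselect (rV_box n M x).
    by rewrite mem_set // mulr1n (le_trans (fC x)) // mul1r ler_norm.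
  by rewrite f0 // normr0.
apply: (@eq_integrable _ _ _ _ _ _
    (fun x => (C%:E * (EFin \o \1_(rV_box n M)) x)%E)) => //.
  by move=> x _ /=; rewrite -EFinM mulrC.
apply: integrableZl => //; apply/integrableP; split.
  by apply/measurable_EFinP/measurable_indic; exact: measurable_rV_box.
under eq_integral do rewrite /= ger0_norm //.
rewrite integral_indic //; last exact: measurable_rV_box.
by rewrite setIT; exact: lebesgue_rV_box_lty.
Qed.

End lebesgue_rV_support.

(** * Continuous functions with compact support *)

Section compact_support.
Context (R : realType) (n : nat).
Local Notation mu := (lebesgue_rV R n).
Implicit Types (K Omega : set 'rV[R]_n) (f g phi : 'rV[R]_n -> R).

(** The support clause of [test_function], isolated because products, sums and partial derivatives
    inherit it. *)
Definition compactly_supported Omega f := exists K,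
  [/\ compact K, K `<=` Omega & forall x, ~ K x -> f x = 0].

Lemma compact_sub_rV_box K : compact K -> exists2 M : R, 0 < M & K `<=` rV_box n M.
Proof. by move=> /compact_bounded /bounded_rV_coord. Qed.

Lemma compactly_supported_bounded Omega f :
  continuous f -> compactly_supported Omega f ->
  exists C, forall x, `|f x| <= C.
Proof.
move=> cf [K [cK _ f0]].
have : compact (f @` K).
  by apply: continuous_compact => //; exact: continuous_subspaceT.
move=> /compact_bounded[C [Cr hC]]; exists (`|C| + 1) => x.
have [Kx|nKx] := pselect (K x); last by rewrite f0 // normr0 addr_ge0.
by apply: hC; [rewrite (le_lt_trans (ler_norm C)) // ltrDl|exists x].
Qed.

Lemma compactly_supported_integrable Omega f :
  continuous f -> compactly_supported Omega f ->
  mu.-integrable setT (EFin \o f).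
Proof.
move=> cf sf; have [C hC] := compactly_supported_bounded cf sf.
have [K [cK _ f0]] := sf; have [M _ KM] := compact_sub_rV_box cK.
apply: (@integrable_bounded_support _ _ f M C) => //.
  exact: continuous_measurable_rV.
by move=> x nx; apply: f0 => /KM.
Qed.

Lemma compactly_supportedMl Omega f g :
  compactly_supported Omega f -> compactly_supported Omega (fun x => g x * f x).
Proof.
by move=> [K [cK KO f0]]; exists K; split => // x nKx; rewrite f0 // mulr0.
Qed.

Lemma compactly_supportedD Omega f g :
  compactly_supported Omega f -> compactly_supported Omega g ->
  compactly_supported Omega (f + g).
Proof.
move=> [K [cK KO f0]] [L [cL LO g0]]; exists (K `|` L); split.
- exact: compactU.
- by move=> x [/KO|/LO].
- by move=> x /not_orP[nK nL]; rewrite fctE f0 // g0 // addr0.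
Qed.

Lemma compactly_supported_partial Omega f i :
  compactly_supported Omega f -> compactly_supported Omega (partial i f).
Proof.
move=> [K [cK KO f0]]; exists K; split => // x nKx; rewrite /partial.
rewrite (@near_eq_derive _ _ _ _ (cst 0)) ?derive_cst //.
have : nbhs x (~` K).
  apply: (@open_nbhs_nbhs _ x (~` K)); split => //.
  by apply: closed_openC; apply: compact_closed cK; exact: norm_hausdorff.
by apply: filterS => y; exact: f0.
Qed.

End compact_support.

(** * Vanishing integral of a partial derivative *)

Section poincare.
Context (R : realType) (n : nat).
Local Notation mu := (lebesgue_rV R n.+1).
Local Notation e0 := (delta_mx 0 0 : 'rV[R]_n.+1).

Lemma cons_rVD (h t : R) y : h *: e0 + cons_rV (t, y) = cons_rV (h + t, y).
Proof.
apply/rowP => i; rewrite mxE [X in X + _]mxE [X in _ * X]mxE.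
case: (unliftP 0 i) => [j|] ->.
  by rewrite !cons_rVS /= mulr0 add0r.
by rewrite !cons_rV0 /= mulr1.
Qed.

(** By [cons_rVD] the difference quotients of [F] along [e0] and of its slice are the same function
    of the increment. *)
Lemma is_derive_cons_rV (F : 'rV[R]_n.+1 -> R) y t (l : R) :
  is_derive (cons_rV (t, y)) e0 F l -> is_derive t 1 (fun t => F (cons_rV (t, y))) l.
Proof.
pose x := cons_rV (t, y).
have E : (fun h : R => h^-1 *: ((F \o shift x) (h *: e0) - F x)) =
  (fun h : R => h^-1 *:
    (((fun t => F (cons_rV (t, y))) \o shift t) (h *: (1 : R)) - F x)).
  apply/funext => h /=; rewrite [in RHS](_ : _%:A + t = h + t) ?cons_rVD //.
  by rewrite /GRing.scale/= mulr1.
case=> dF Fl; split; first by rewrite /derivable -E.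
by rewrite -Fl /derive -E.
Qed.

Lemma continuous_cons_rV y : continuous (fun t : R => @cons_rV R n (t, y)).
Proof.
move=> t; apply/cvgrPdist_lt => e e_gt0; near=> s.
have -> : cons_rV (t, y) - cons_rV (s, y) = (t - s) *: e0.
  by rewrite -{1}[t](subrK s) -cons_rVD addrK.
have e1 : 0 < `|e0| + 1 by rewrite ltr_wpDl.
rewrite normrZ (@le_lt_trans _ _ (`|t - s| * (`|e0| + 1))) //.
  by rewrite ler_wpM2l // lerDl.
rewrite -ltr_pdivlMr //; near: s.
by apply: cvgr_dist_lt; [exact: cvg_id|rewrite divr_gt0].
Unshelve. all: by end_near. Qed.

(** The measure is the image under [cons_rV] of a product, so Fubini reduces the claim to slices in
    coordinate 0, each the derivative of a function of bounded support on the line. *)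
Lemma integral_partial0 (F f : 'rV[R]_n.+1 -> R) :
  compactly_supported setT F -> compactly_supported setT f -> continuous f ->
  (forall x, is_derive x e0 F (f x)) ->
  (\int[mu]_x (f x)%:E = 0)%E.
Proof.
move=> sF sf cf dF.
have intf := compactly_supported_integrable cf sf.
have mcons := @measurable_cons_rV R n.
have mf : measurable_fun setT (EFin \o f).
  by apply/measurable_EFinP; exact: continuous_measurable_rV.
have intfc : (lebesgue_measure \x lebesgue_rV R n)%E.-integrable setT
    ((EFin \o f) \o @cons_rV R n).
  apply/integrableP; split; first exact: measurableT_comp.
  move/integrableP : intf => [_]; apply: le_lt_trans.
  rewrite /= ge0_integral_pushforward //=.
  by apply/measurable_EFinP/measurableT_comp => //; exact: continuous_measurable_rV.
apply: etrans (integral_pushforward mcons mf intfc measurableT) _.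
rewrite preimage_setT -(integral21_prod_meas1 intfc).
rewrite (eq_integral (cst 0%E)) ?integral0 // => y _; rewrite /fubini_G /=.
have [K [cK _ F0]] := sF; have [M M0 KM] := compact_sub_rV_box cK.
apply: (@integral_derive_compact _ (fun t => F (cons_rV (t, y))) _ M) => //.
- by move=> t; apply: is_derive_cons_rV.
- by move=> t; apply: continuous_comp; [exact: continuous_cons_rV|exact: cf].
- move=> t Mt; apply: F0 => /KM /(_ 0); rewrite cons_rV0 /=.
  by rewrite leNgt Mt.
Qed.

End poincare.

(** * The Poincare inequality and H^1_0 *)

Section poincare_test.
Context (R : realType) (n : nat).
Local Notation mu := (lebesgue_rV R n.+1).
Local Notation e0 := (delta_mx 0 0 : 'rV[R]_n.+1).

Lemma is_derive_coord0 (x : 'rV[R]_n.+1) :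
  is_derive x e0 (fun x : 'rV[R]_n.+1 => x 0 0) 1.
Proof.
have h : (fun h : R => h^-1 *:
    (((fun x : 'rV[R]_n.+1 => x 0 0) \o shift x) (h *: e0) - x 0 0))
    @ 0^' --> (1 : R).
  apply: (@cvg_trans _ ((cst 1 : R -> R) @ 0^')); last exact: cvg_cst.
  apply: near_eq_cvg; near=> h => /=.
  rewrite !mxE /= mulr1 addrK /GRing.scale /= mulVf //.
  by near: h; exact: nbhs_dnbhs_neq.
by split; [exact: cvgP h|exact: cvg_lim].
Unshelve. all: by end_near. Qed.

Lemma L2dot_setT (Omega : set 'rV[R]_n.+1) (f g : 'rV[R]_n.+1 -> R) :
  compactly_supported Omega f ->
  L2dot Omega f g = \int[mu]_x (f x * g x).
Proof.
move=> [K [_ KO f0]]; rewrite /L2dot Rintegral_mkcond; congr Rintegral.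
apply/funext => x; rewrite patchE; case: ifPn => // /negP; rewrite inE => nO.
by rewrite f0 ?mul0r // => /KO.
Qed.

Lemma poincare_test_function (Omega : set 'rV[R]_n.+1) (M : R)
    (phi : 'rV[R]_n.+1 -> R) :
  Omega `<=` rV_box n.+1 M -> continuous phi -> continuous (partial 0 phi) ->
  (forall x, derivable phi x e0) -> compactly_supported Omega phi ->
  L2dot Omega phi phi <= 4 * M ^+ 2 * L2dot Omega (partial 0 phi) (partial 0 phi).
Proof.
move=> OM cphi cdphi dphi sphi; set psi := partial 0 phi in cdphi *.
have spsi : compactly_supported Omega psi by exact: compactly_supported_partial.
rewrite !L2dot_setT //.
have cx : continuous (fun x : 'rV[R]_n.+1 => x 0 0) by exact: coord_continuous.
pose h x := phi x * phi x + 2 * x 0 0 * psi x * phi x.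
have toT f : compactly_supported Omega f -> compactly_supported setT f.
  by move=> [K [cK _ f0]]; exists K.
have sh : compactly_supported setT h.
  apply: toT; apply: (@compactly_supportedD _ _ _ (fun x => phi x * phi x)
    (fun x => 2 * x 0 0 * psi x * phi x)); exact: compactly_supportedMl.
have ch : continuous h.
  move=> x; apply: (cvgD (cvgM (cphi x) (cphi x))).
  have c2 : {for x, continuous (cst 2 : 'rV[R]_n.+1 -> R)} by apply: cst_continuous.
  exact: continuousM (continuousM (continuousM c2 (cx x)) (cdphi x)) (cphi x).
have dF x : is_derive x e0 (fun x => x 0 0 * (phi x * phi x)) (h x).
  have dphix : is_derive x e0 phi (psi x) by split => //.
  have dxx := is_derive_coord0 x.
  apply: is_derive_eq (is_deriveM dxx (is_deriveM dphix dphix)) _.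
  rewrite /h /GRing.scale /= fctE; ring.
have sF : compactly_supported setT (fun x => x 0 0 * (phi x * phi x)).
  by apply: toT; apply: compactly_supportedMl; exact: compactly_supportedMl.
have h0 := integral_partial0 sF sh ch dF.
have sqi f : continuous f -> compactly_supported Omega f ->
    mu.-integrable setT (EFin \o (fun x => f x * f x)).
  move=> cf sf; apply: (@compactly_supported_integrable _ _ Omega).
    by move=> x; exact: cvgM (cf x) (cf x).
  exact: compactly_supportedMl.
have iphi := sqi _ cphi sphi; have ipsi := sqi _ cdphi spsi.
(* Half the square of phi + 2 x_0 psi shows 2 x_0 psi phi >= - phi^2 / 2 - 2 x_0^2 psi^2, and |x_0|
   <= M on [Omega]; off [Omega] everything is 0. Doubling the integrated inequality gives the
   constant 4 M^2. *)
have : \int[mu]_x (2^-1 * (phi x * phi x) - 2 * M ^+ 2 * (psi x * psi x))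
    <= \int[mu]_x h x.
  apply: le_Rintegral => //.
  - apply: (@integrableB _ _ _ _ _ _ (fun x => (2^-1 * (phi x * phi x))%:E)
      (fun x => (2 * M ^+ 2 * (psi x * psi x))%:E)) => //.
      exact: integrableZl iphi.
    exact: integrableZl ipsi.
  - exact: compactly_supported_integrable sh.
  - move=> x _; rewrite /h; have [Ox|nOx] := pselect (Omega x).
      have : `|x 0 0| ^+ 2 <= M ^+ 2.
        by rewrite ler_sqr ?nnegrE ?(le_trans _ (OM _ Ox 0)) //; exact: OM.
      rewrite real_normK ?num_real //.
      have := sqr_ge0 (phi x + 2 * x 0 0 * psi x).
      have := sqr_ge0 (psi x).
      move: (x 0 0) (phi x) (psi x) => a p q; nra.
    have [K [_ KO f0]] := sphi; have [L [_ LO g0]] := spsi.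
    by rewrite f0 ?g0; [lra|move=> /LO|move=> /KO].
rewrite [X in _ <= X -> _](_ : _ = 0); last by rewrite /Rintegral h0.
rewrite RintegralB //; last 2 first.
- exact: integrableZl iphi.
- exact: integrableZl ipsi.
rewrite !RintegralZl //.
by move: (\int[_]_x _) (\int[_]_x _) => a b; lra.
Qed.

End poincare_test.

(** * Linear structure and square integrability of test functions *)

Section test_functions.
Context (R : realType) (d : nat).
Local Notation E := 'rV[R]_d.
Implicit Types (f g phi : E -> R) (Omega : set E).

Lemma partialDZ i a f g : (forall x, derivable f x (delta_mx 0 i)) ->
  (forall x, derivable g x (delta_mx 0 i)) ->
  partial i (a *: f + g) = a *: partial i f + partial i g.
Proof.
move=> df dg; apply/funext => x; rewrite /partial deriveD ?deriveZ //.
exact: derivableZ.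
Qed.

Lemma continuousDZ a f g : continuous f -> continuous g -> continuous (a *: f + g).
Proof.
move=> cf cg x; apply: (@continuousD _ _ _ (a *: f) g x) (cg x).
exact: (@continuousM _ _ (cst a) f x) (@cst_continuous _ _ a x) (cf x).
Qed.

Lemma class_CDZ k a f g : class_C k f -> class_C k g -> class_C k (a *: f + g).
Proof.
elim: k f g => [|k IHk] f g [cf hf] [cg hg].
  by split=> //; exact: continuousDZ.
split; first exact: continuousDZ.
move=> i; have [df Cf] := hf i; have [dg Cg] := hg i; split.
  by move=> x; apply: derivableD => //; exact: derivableZ.
by rewrite partialDZ //; exact: IHk.
Qed.

Lemma class_C0 k : class_C k (0 : E -> R).
Proof.
have c0 : continuous (0 : E -> R) by exact: cst_continuous.
elim: k => [//|k IHk]; split => // i; split; first by move=> x; exact: derivable_cst.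
suff -> : partial i (0 : E -> R) = 0 by [].
by apply/funext => x; rewrite /partial derive_cst.
Qed.

Lemma test_functionDZ Omega a f g : test_function Omega f -> test_function Omega g ->
  test_function Omega (a *: f + g).
Proof.
move=> [Cf sf] [Cg sg]; split; first by move=> k; exact: class_CDZ.
apply: compactly_supportedD => //; exact: (@compactly_supportedMl _ _ _ _ (cst a)).
Qed.

Lemma test_function0 Omega : test_function Omega 0.
Proof.
split; first exact: class_C0.
by exists set0; split => //; exact: compact0.
Qed.

Lemma test_function_continuous Omega phi : test_function Omega phi -> continuous phi.
Proof. by move=> [/(_ 0)[]]. Qed.

Lemma test_function_partial Omega phi i : test_function Omega phi ->
  (forall x, derivable phi x (delta_mx 0 i)) /\ continuous (partial i phi).
Proof. by move=> [/(_ 1)[_ /(_ i)[? []]]]. Qed.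

Lemma gradDZ Omega a f g : test_function Omega f -> test_function Omega g ->
  grad (a *: f + g) = a *: grad f + grad g.
Proof.
move=> tf tg; apply/funext => x; apply/rowP => i; rewrite !fctE !mxE partialDZ //.
- by have [] := test_function_partial i tf.
- by have [] := test_function_partial i tg.
Qed.

Lemma compactly_supported_L2 Omega f : measurable Omega ->
  continuous f -> compactly_supported Omega f -> L2 Omega f.
Proof.
move=> mO cf sf; apply/L2P => //; split.
  exact: measurable_funTS (continuous_measurable_rV cf).
have cff : continuous (fun x => f x * f x) by move=> x; exact: continuousM (cf x) (cf x).
have := compactly_supported_integrable cff (compactly_supportedMl f sf).
move=> /(integrableS measurableT mO (@subsetT _ _)) /integrableP[_].
by under eq_integral do rewrite /= ger0_norm -?expr2 ?sqr_ge0 // expr2.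
Qed.

Lemma test_function_L2 Omega phi : measurable Omega ->
  test_function Omega phi -> L2 Omega phi.
Proof.
move=> mO tphi; apply: compactly_supported_L2 => //; last exact: tphi.2.
exact: test_function_continuous tphi.
Qed.

Lemma partial_test_function_L2 Omega phi i : measurable Omega ->
  test_function Omega phi -> L2 Omega (partial i phi).
Proof.
move=> mO tphi; apply: compactly_supported_L2 => //.
  by have [] := test_function_partial i tphi.
exact: compactly_supported_partial tphi.2.
Qed.

Lemma grad_test_function_L2v Omega phi : measurable Omega ->
  test_function Omega phi -> L2v Omega (grad phi).
Proof.
move=> mO tphi i.
rewrite (_ : (fun x => _) = partial i phi); first exact: partial_test_function_L2.
by apply/funext => x; rewrite mxE.
Qed.
End test_functions.

Lemma weighted_sum_lt (R : realFieldType) (e a p q : R) : 0 <= p -> 0 <= q ->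
  p < e / (4 * (a ^+ 2 + 1)) -> q < e / (4 * (a ^+ 2 + 1)) ->
  2 * a ^+ 2 * p + 2 * q < e.
Proof.
have c0 : 0 < 4 * (a ^+ 2 + 1) by rewrite mulr_gt0 // ltr_wpDl ?sqr_ge0.
rewrite !ltr_pdivlMr // => p0 q0 hp hq.
have := mulr_ge0 (sqr_ge0 a) q0; lra.
Qed.

Lemma double_sum_lt (R : realFieldType) (e p q : R) :
  p < e / 4 -> q < e / 4 -> 2 * p + 2 * q < e.
Proof. lra. Qed.

(** Here [b] and [bv] are the squared errors of approximation by a test function phi and its
    gradient, [u] and [w] the squared norms of the approximated function and its gradient, and [f],
    [g], [p] those of phi, its gradient and its derivative in direction 0. Then u <= 2 e + 8 M^2 p
    <= 2 e + 16 M^2 (e + w). *)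
Lemma poincare_limit (R : realFieldType) (M e b bv u f p g w : R) :
  0 <= w -> 0 <= b -> 0 <= bv -> b + bv < e -> g <= 2 * bv + 2 * w ->
  u <= 2 * b + 2 * f -> p <= g -> f <= 4 * M ^+ 2 * p ->
  u <= 16 * (M ^+ 2 + 1) * (w + e).
Proof.
move=> w0 b0 bv0 be gw ub pg fp; have M0 := sqr_ge0 M.
have : M ^+ 2 * p <= M ^+ 2 * (2 * e + 2 * w).
  by rewrite ler_wpM2l //; lra.
lra.
Qed.

(** * H^1_0 as a closed subspace of L^2 x [L^2]^d *)

Section H1_0_space.
Context (R : realType) (d : nat) (Omega : set 'rV[R]_d).
Hypothesis mO : measurable Omega.
Local Notation E := 'rV[R]_d.
Local Notation W := ((E -> R) * (E -> E))%type.
Local Notation L2 := (L2 Omega).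
Local Notation dot := (L2dot Omega).
Local Notation L2v := (L2v Omega).
Local Notation dotv := (L2dotv Omega).
Local Notation H1_0 := (H1_0 Omega).
Implicit Types w : W.

(** The ambient complete space: here the second component is not yet tied to the first. Where it is
    the weak gradient, [H1dot] is the H^1 inner product. *)
Definition L2L2v : W -> Prop := prod_sub L2 L2v.
Definition H1dot : W -> W -> R := prod_dot dot dotv.

Lemma prehilbert_L2L2v : prehilbert L2L2v H1dot.
Proof. exact: prehilbert_prod (prehilbert_L2 mO) (prehilbert_L2v mO). Qed.

Lemma sqcomplete_L2L2v : sqcomplete L2L2v H1dot.
Proof.
exact: sqcomplete_prod (prehilbert_L2 mO) (prehilbert_L2v mO)
  (sqcomplete_L2 mO) (sqcomplete_L2v mO).
Qed.

Lemma test_function_L2L2v phi : test_function Omega phi -> L2L2v (phi, grad phi).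
Proof.
by split; [exact: test_function_L2|exact: grad_test_function_L2v].
Qed.

Lemma sqr_L2norm u : L2norm Omega u ^+ 2 = dot u u.
Proof. by rewrite sqr_sqrtr // Rintegral_ge0 // => x _; rewrite -expr2 sqr_ge0. Qed.

Lemma sqr_L2normv F : L2normv Omega F ^+ 2 = dotv F F.
Proof.
rewrite sqr_sqrtr // Rintegral_ge0 // => x _; apply: sumr_ge0 => i _.
by rewrite -expr2 sqr_ge0.
Qed.

(* Having [w.2] as weak gradient means that [w] is orthogonal to all the
   [gradient_probe phi i], a condition that is stable under limits. *)
Definition gradient_probe (phi : E -> R) i : W :=
  (partial i phi, fun x => phi x *: delta_mx 0 i).

Lemma gradient_probe_L2L2v phi i : test_function Omega phi ->
  L2L2v (gradient_probe phi i).
Proof.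
move=> tphi; split; first exact: partial_test_function_L2.
move=> j; have [->|ij] := eqVneq j i.
  rewrite (_ : (fun x => _) = phi); first exact: test_function_L2.
  by apply/funext => x; rewrite !mxE !eqxx mulr1.
have := prehilbert0 (prehilbert_L2 mO); congr Defs.L2.
by apply/funext => x; rewrite !mxE (negbTE ij) andbF mulr0.
Qed.

Lemma H1dot_gradient_probe w phi i :
  H1dot w (gradient_probe phi i) =
  dot w.1 (partial i phi) + dot (fun x => w.2 x 0 i) phi.
Proof.
congr (_ + _); apply: eq_Rintegral => x _; rewrite (bigD1 i) //= big1 => [|j ji].
  by rewrite !mxE !eqxx mulr1 addr0.
by rewrite !mxE (negbTE ji) andbF !mulr0.
Qed.

(** Phrasing everything with [H1dot] makes the abstract lemmas applicable, both for linear
    combinations and for limits. The tolerance e stands for the eps^2 of the definition. *)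
Lemma H1_0P w : H1_0 w <->
  [/\ L2L2v w,
      forall phi i, test_function Omega phi -> H1dot w (gradient_probe phi i) = 0 &
      forall e : R, 0 < e -> exists2 phi, test_function Omega phi &
        H1dot (w - (phi, grad phi)) (w - (phi, grad phi)) < e].
Proof.
split=> [[[L1 L2 wg] h]|[[L1 L2] wg h]].
  split=> //; first by move=> phi i tphi; rewrite H1dot_gradient_probe wg // addNr.
  move=> e e0; have s0 : 0 < Num.sqrt e by rewrite sqrtr_gt0.
  have [phi tphi hphi] := h _ s0; exists phi => //.
  by move: hphi; rewrite sqr_L2norm sqr_L2normv sqr_sqrtr // ltW.
split; first split => //.
  move=> phi i /wg-/(_ i); rewrite H1dot_gradient_probe => /eqP.
  by rewrite addr_eq0 => /eqP.
move=> e e0; have [phi tphi hphi] := h _ (exprn_gt0 2 e0); exists phi => //.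
by rewrite sqr_L2norm sqr_L2normv.
Qed.

Lemma prehilbert_H1_0 : prehilbert H1_0 H1dot.
Proof.
have H := prehilbert_L2L2v.
apply: (prehilbert_sub H).
- by move=> w /H1_0P[].
- apply/H1_0P; split; first exact: prehilbert0 H.
    move=> phi i /gradient_probe_L2L2v-/(_ i) Lg.
    by have := linear_on0 H (linear_dotl H Lg).
  move=> e e0; exists 0; first exact: test_function0.
  have -> : (0, grad 0) = 0 :> W.
    congr pair; apply/funext => x; apply/rowP => i; rewrite !mxE.
    by rewrite /partial derive_cst.
  by rewrite subrr (linear_on0 H (linear_dotl H (prehilbert0 H))).
move=> a u v /H1_0P[Lu gu hu] /H1_0P[Lv gv hv]; apply/H1_0P; split.
- by have := prehilbertDZ H a Lu Lv.
- move=> phi i tphi; have Lg := gradient_probe_L2L2v i tphi.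
  by rewrite (dotDZl H) // gu // gv // mulr0 addr0.
move=> e e0; have c0 : 0 < 4 * (a ^+ 2 + 1) by rewrite mulr_gt0 // ltr_wpDl ?sqr_ge0.
have [f tf hf] := hu _ (divr_gt0 e0 c0).
have [g tg hg] := hv _ (divr_gt0 e0 c0).
exists (a *: f + g); first exact: test_functionDZ.
have Lf := test_function_L2L2v tf; have Lg := test_function_L2L2v tg.
have -> : a *: u + v - (a *: f + g, grad (a *: f + g)) =
    a *: (u - (f, grad f)) + (v - (g, grad g)).
  rewrite (gradDZ a tf tg) (_ : (_, _) = a *: (f, grad f) + (g, grad g)) //.
  by rewrite scalerBr opprD addrACA.
have Lu' := subspaceB H Lu Lf; have Lv' := subspaceB H Lv Lg.
apply: le_lt_trans (dot_sqrDZ_le H a Lu' Lv') _.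
exact: weighted_sum_lt (dot_ge0 H Lu') (dot_ge0 H Lv') hf hg.
Qed.

(** Only closedness has to be checked: orthogonality to the probes passes to the limit, and a test
    function close to a late term of the sequence is close to the limit. *)
Lemma sqcomplete_H1_0 : sqcomplete H1_0 H1dot.
Proof.
have H := prehilbert_L2L2v.
apply: sqcomplete_sub sqcomplete_L2L2v; first by move=> w /H1_0P[].
move=> u l Hu Ll ul; apply/H1_0P; split => //.
  move=> phi i tphi; have Lg := gradient_probe_L2L2v i tphi.
  apply: (dot_eq0_closed H _ Ll Lg ul) => n.
    by have /H1_0P[] := Hu n.
  by have /H1_0P[_ -> ] := Hu n.
move=> e e0; have e4 : 0 < e / 4 by rewrite divr_gt0.
have [N /(_ _ (leqnn N)) hN] := ul _ e4.
have /H1_0P[LN _ /(_ _ e4)[phi tphi hphi]] := Hu N.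
exists phi => //.
have Lphi := test_function_L2L2v tphi.
have -> : l - (phi, grad phi) = (l - u N) + (u N - (phi, grad phi)).
  by rewrite addrA subrK.
apply: le_lt_trans (dot_sqrD_le H (subspaceB H Ll LN) (subspaceB H LN Lphi)) _.
rewrite (dot_sqrB H) //.
exact: double_sum_lt hN hphi.
Qed.
End H1_0_space.

Lemma poincare_H1_0 (R : realType) (n : nat) (Omega : set 'rV[R]_n.+1) (M : R)
  w : measurable Omega -> Omega `<=` rV_box n.+1 M -> H1_0 Omega w ->
  L2dot Omega w.1 w.1 <= 16 * (M ^+ 2 + 1) * L2dotv Omega w.2 w.2.
Proof.
move=> mO OM /H1_0P[[L1 L2] _ h].
have H := prehilbert_L2 mO; have Hv := prehilbert_L2v mO.
have c0 : 0 < 16 * (M ^+ 2 + 1) by rewrite mulr_gt0 // ltr_wpDl ?sqr_ge0.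
(* Dividing by the constant first puts the slack e next to the gradient term, as in
   [poincare_limit]. *)
rewrite -ler_pdivrMl //; apply/ler_addgt0Pr => e e0; rewrite ler_pdivrMl //.
have [phi tphi] := h _ e0; rewrite /H1dot /prod_dot /=.
have Lphi := test_function_L2 mO tphi; have Lgrad := grad_test_function_L2v mO tphi.
have LB := subspaceB H L1 Lphi; have LBv := subspaceB Hv L2 Lgrad.
have := poincare_test_function OM (test_function_continuous tphi)
  (test_function_partial 0 tphi).2 (test_function_partial 0 tphi).1 tphi.2.
have := coord_le_L2dotv mO 0 Lgrad.
rewrite (_ : (fun x => _) = partial 0 phi); last by apply/funext => x; rewrite mxE.
have := dot_sqrD_le H LB Lphi; rewrite subrK.
have := dot_sqrD_le Hv (subspaceN Hv LBv) L2.
rewrite opprB subrK (dot_sqrB Hv Lgrad L2).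
move=> h4 h3 h2 h1 h0.
exact: (@poincare_limit _ M e _ _ _ _ _ _ _ (dot_ge0 Hv L2) (dot_ge0 H LB)
  (dot_ge0 Hv LBv) h0 h4 h3 h2 h1).
Qed.

(** * The primal problem *)

(** Continuity of the reduced form, with z = zeta and k = kappa^-1: the square of a sum of four
    terms is at most four times the sum of their squares. *)
Lemma four_term_sqr_le (R : realFieldType) (z k a b c d P : R) :
  a ^+ 2 <= P -> b ^+ 2 <= P -> c ^+ 2 <= P -> d ^+ 2 <= P ->
  (a + z * b + k * c - z * d) ^+ 2 <= 4 * (1 + 2 * z ^+ 2 + k ^+ 2) * P.
Proof.
move=> hA hB hC hD.
have hb : (z * b) ^+ 2 <= z ^+ 2 * P by rewrite exprMn ler_wpM2l ?sqr_ge0.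
have hc : (k * c) ^+ 2 <= k ^+ 2 * P by rewrite exprMn ler_wpM2l ?sqr_ge0.
have hd : (z * d) ^+ 2 <= z ^+ 2 * P by rewrite exprMn ler_wpM2l ?sqr_ge0.
move: (z * b) (k * c) (z * d) hb hc hd => b' c' d' hb hc hd.
have := sqr_ge0 (a - b'); have := sqr_ge0 (a - c'); have := sqr_ge0 (a + d').
have := sqr_ge0 (b' - c'); have := sqr_ge0 (b' + d'); have := sqr_ge0 (c' + d').
nra.
Qed.

Lemma three_term_sqr_le (R : realFieldType) (a b c A B C P : R) :
  a ^+ 2 <= A * P -> b ^+ 2 <= B * P -> c ^+ 2 <= C * P ->
  (a - b - c) ^+ 2 <= 3 * (A + B + C) * P.
Proof.
move=> hA hB hC.
have := sqr_ge0 (a + b); have := sqr_ge0 (a + c); have := sqr_ge0 (b - c); nra.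
Qed.

(** Poincare gives u + a + l + b <= (C + 1) (a + b), and (1 + k) (a + b / k) exceeds a + b by k a +
    b / k. *)
Lemma coercivity_bound (R : realFieldType) (C k a b u l : R) :
  0 <= C -> 0 < k -> 0 <= a -> 0 <= b -> u <= C * a -> l <= C * b ->
  ((C + 1) * (1 + k))^-1 * (u + a + (l + b)) <= a + k^-1 * b.
Proof.
move=> C0 k0 a0 b0 ua lb.
have C1 : 0 < C + 1 by rewrite ltr_wpDl.
have k1 : 0 < 1 + k by rewrite addr_gt0.
rewrite ler_pdivrMl ?mulr_gt0 // -mulrA.
have e : (1 + k) * (a + k^-1 * b) = a + b + (k * a + k^-1 * b).
  by field; rewrite gt_eqF.
have p : 0 <= k * a + k^-1 * b.
  by rewrite addr_ge0 // mulr_ge0 // ?invr_ge0 ltW.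
have : (C + 1) * (a + b) <= (C + 1) * ((1 + k) * (a + k^-1 * b)).
  by rewrite ler_pM2l // e lerDl.
lra.
Qed.

(** * Lax-Milgram on H^1_0 x H^1_0 *)

Section solve.
Context (R : realType) (d : nat) (Omega : set 'rV[R]_d).
Hypothesis mO : measurable Omega.
Local Notation E := 'rV[R]_d.
Local Notation W := ((E -> R) * (E -> E))%type.
Local Notation L2 := (L2 Omega).
Local Notation dot := (L2dot Omega).
Local Notation L2v := (L2v Omega).
Local Notation dotv := (L2dotv Omega).
Local Notation H1_0 := (H1_0 Omega).
Local Notation H1dot := (H1dot Omega).
Variables (C zeta kappa : R).
Hypotheses (C0 : 0 <= C) (k0 : 0 < kappa).
Hypothesis poincare : forall w, H1_0 w -> dot w.1 w.1 <= C * dotv w.2 w.2.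
Let H := prehilbert_L2 mO.
Let Hv := prehilbert_L2v mO.

Let VV : (W * W)%type -> Prop := prod_sub H1_0 H1_0.
Let dd : (W * W)%type -> (W * W)%type -> R := prod_dot H1dot H1dot.
Let HH : prehilbert VV dd.
Proof. exact: prehilbert_prod (prehilbert_H1_0 mO) (prehilbert_H1_0 mO). Qed.

(** The sum of the two reduced equations, tested with [y.1] and [y.2]; [x.1] is u and [x.2] is
    lambda, each paired with its gradient. *)
Let B (x y : W * W) : R := dotv x.1.2 y.1.2 + zeta * dot x.2.1 y.1.1
  + kappa^-1 * dotv x.2.2 y.2.2 - zeta * dot x.1.1 y.2.1.
Let F et st q (y : W * W) : R := dotv et y.1.2 - dot q y.2.1 - dotv st y.2.2.

Let comps x : VV x -> [/\ L2 x.1.1, L2v x.1.2, L2 x.2.1 & L2v x.2.2].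
Proof. by move=> [/H1_0P[[? ?] _ _] /H1_0P[[? ?] _ _]]. Qed.

Let comps_le x : VV x -> [/\ dot x.1.1 x.1.1 <= dd x x, dotv x.1.2 x.1.2 <= dd x x,
  dot x.2.1 x.2.1 <= dd x x & dotv x.2.2 x.2.2 <= dd x x].
Proof.
move=> /comps[h1 h2 h3 h4].
have := dot_ge0 H h1; have := dot_ge0 Hv h2.
have := dot_ge0 H h3; have := dot_ge0 Hv h4.
rewrite /dd /prod_dot /H1dot /prod_dot.
move: (dot _ _) (dotv _ _) (dot _ _) (dotv _ _) => a b c e *; split; lra.
Qed.

Let csM (f g : E -> R) P Q : L2 f -> L2 g -> dot f f <= P -> dot g g <= Q ->
  dot f g ^+ 2 <= P * Q.
Proof.
move=> Lf Lg fP gQ; apply: le_trans (cauchy_schwarz H Lf Lg) _.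
by rewrite ler_pM // ?(dot_ge0 H).
Qed.

Let csvM (f g : E -> E) P Q : L2v f -> L2v g -> dotv f f <= P -> dotv g g <= Q ->
  dotv f g ^+ 2 <= P * Q.
Proof.
move=> Lf Lg fP gQ; apply: le_trans (cauchy_schwarz Hv Lf Lg) _.
by rewrite ler_pM // ?(dot_ge0 Hv).
Qed.

Let BlinL w : VV w -> linear_on VV (B^~ w).
Proof.
move=> /comps[w1 w2 w3 w4] a u v /comps[u1 u2 u3 u4] /comps[v1 v2 v3 v4].
rewrite /B /= (dotDZl Hv a u2 v2 w2) (dotDZl H a u3 v3 w1).
rewrite (dotDZl Hv a u4 v4 w4) (dotDZl H a u1 v1 w3).
ring.
Qed.

Let BlinR w : VV w -> linear_on VV (B w).
Proof.
move=> /comps[w1 w2 w3 w4] a u v /comps[u1 u2 u3 u4] /comps[v1 v2 v3 v4].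
rewrite /B /= (linear_dotr Hv w2 a u2 v2) (linear_dotr H w3 a u1 v1).
rewrite (linear_dotr Hv w4 a u4 v4) (linear_dotr H w1 a u3 v3).
ring.
Qed.

Let Flin et st q : L2v et -> L2v st -> L2 q -> linear_on VV (F et st q).
Proof.
move=> Let_ Lst Lq a u v /comps[u1 u2 u3 u4] /comps[v1 v2 v3 v4].
rewrite /F /= (linear_dotr Hv Let_ a u2 v2) (linear_dotr H Lq a u3 v3).
rewrite (linear_dotr Hv Lst a u4 v4).
ring.
Qed.

Let Bbound u v : VV u -> VV v ->
  B u v ^+ 2 <= 4 * (1 + 2 * zeta ^+ 2 + kappa^-1 ^+ 2) * dd u u * dd v v.
Proof.
move=> Vu Vv; have [u1 u2 u3 u4] := comps Vu; have [v1 v2 v3 v4] := comps Vv.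
have [lu1 lu2 lu3 lu4] := comps_le Vu; have [lv1 lv2 lv3 lv4] := comps_le Vv.
rewrite -mulrA; apply: four_term_sqr_le.
- exact: csvM.
- exact: csM.
- exact: csvM.
- exact: csM.
Qed.

Let Fbound et st q v : L2v et -> L2v st -> L2 q -> VV v ->
  F et st q v ^+ 2 <= 3 * (dotv et et + dot q q + dotv st st) * dd v v.
Proof.
move=> Let_ Lst Lq Vv; have [v1 v2 v3 v4] := comps Vv.
have [lv1 lv2 lv3 lv4] := comps_le Vv.
by apply: three_term_sqr_le; [exact: csvM|exact: csM|exact: csvM].
Qed.

Let Bcoercive u : VV u -> ((C + 1) * (1 + kappa))^-1 * dd u u <= B u u.
Proof.
move=> Vu; have [u1 u2 u3 u4] := comps Vu.
have -> : B u u = dotv u.1.2 u.1.2 + kappa^-1 * dotv u.2.2 u.2.2.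
  by rewrite /B (dotC H u3 u1); ring.
apply: coercivity_bound => //; rewrite ?(dot_ge0 Hv) //.
  exact: poincare Vu.1.
exact: poincare Vu.2.
Qed.

Lemma reduced_problem et st q : L2v et -> L2v st -> L2 q ->
  exists2 x : W * W, H1_0 x.1 /\ H1_0 x.2 &
    (forall v : W, H1_0 v ->
      dotv x.1.2 v.2 + zeta * dot x.2.1 v.1 = dotv et v.2) /\
    (forall w : W, H1_0 w ->
      kappa^-1 * dotv x.2.2 w.2 - zeta * dot x.1.1 w.1 = - dot q w.1 - dotv st w.2).
Proof.
move=> Let_ Lst Lq.
have sc : sqcomplete VV dd.
  exact: sqcomplete_prod (prehilbert_H1_0 mO) (prehilbert_H1_0 mO)
    (sqcomplete_H1_0 mO) (sqcomplete_H1_0 mO).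
(* [lax_milgram] takes a single constant for the form and the functional; [K1 + K2] serves for
   both. *)
pose K1 := 4 * (1 + 2 * zeta ^+ 2 + kappa^-1 ^+ 2).
pose K2 := 3 * (dotv et et + dot q q + dotv st st).
have K1_ge0 : 0 <= K1.
  by have := sqr_ge0 zeta; have := sqr_ge0 kappa^-1; rewrite /K1; lra.
have K2_ge0 : 0 <= K2.
  have := dot_ge0 H Lq; have := dot_ge0 Hv Let_; have := dot_ge0 Hv Lst.
  by move=> *; rewrite mulr_ge0 // !addr_ge0.
have dd_ge0 u : VV u -> 0 <= dd u u by move=> Vu; have := dot_ge0 HH Vu.
have c0 : 0 < ((C + 1) * (1 + kappa))^-1.
  by rewrite invr_gt0 mulr_gt0 //; [exact: ltr_wpDl|exact: addr_gt0].
have [||x Vx hx] := lax_milgram HH sc c0 (addr_ge0 K1_ge0 K2_ge0) BlinL BlinR _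
    Bcoercive (Flin Let_ Lst Lq) _.
- move=> u v Vu Vv; apply: le_trans (Bbound Vu Vv) _.
  rewrite -[leLHS]mulrA -[leRHS]mulrA.
  by rewrite ler_wpM2r ?lerDl // mulr_ge0 // dd_ge0.
- move=> v Vv; apply: le_trans (Fbound Let_ Lst Lq Vv) _.
  by rewrite ler_wpM2r ?lerDr // dd_ge0.
have [x1 x2 x3 x4] := comps Vx.
have V0 := prehilbert0 (prehilbert_H1_0 mO).
(* The test pairs (v, 0) and (0, w) separate the sum into the two equations again. *)
exists x => //; split.
  move=> v Hv0; have := hx (v, 0) (conj Hv0 V0); rewrite /B /F /=.
  rewrite !(linear_on0 H (linear_dotr H _)) // !(linear_on0 Hv (linear_dotr Hv _)) //.
  by rewrite !mulr0 !subr0 addr0.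
move=> w Hw0; have := hx (0, w) (conj V0 Hw0); rewrite /B /F /=.
rewrite !(linear_on0 H (linear_dotr H _)) // !(linear_on0 Hv (linear_dotr Hv _)) //.
by rewrite !mulr0 !add0r.
Qed.

End solve.

(* The squared norms of u, grad u, lambda, grad lambda, e, s, m, et, st and q are
   [u], [a], [lm], [b], [ee], [ss], [mm], [te], [ts] and [qq]; the [p_i] are the
   inner products in the tested equations, and [l = ell^-2]. *)
Lemma solution_norm_bound (R : realFieldType)
    (C k l D a b u lm ee ss mm te ts qq p1 p2 p3 p4 p5 p6 p7 K0 : R) :
  K0 = 1 + 2 * (C + 1) * k ->
  0 <= C -> 0 < k -> 0 <= l -> 0 <= a -> 0 <= b -> 0 <= te -> 0 <= ts -> 0 <= qq ->
  u <= C * a -> lm <= C * b -> D = te + ts + qq ->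
  a + k^-1 * b = p1 - p2 - p3 -> 2 * p1 <= a + te ->
  - (2 * p2) <= (2 * (C + 1) * k)^-1 * lm + 2 * (C + 1) * k * qq ->
  - (2 * p3) <= (2 * k)^-1 * b + 2 * k * ts ->
  ee = a ->
  p4 + mm = p5 -> 2 * p5 <= 2^-1 * mm + 2 * te -> - (2 * p4) <= 2^-1 * mm + 2 * ee ->
  k * ss = p6 + k * p7 -> 2 * p6 <= k / 2 * ss + 2 / k * b ->
  2 * p7 <= 2^-1 * ss + 2 * ts ->
  l * u + a + ee + k * ss + (k^-1 * l * lm + k^-1 * b + mm) <=
  (2 * l * C * K0 + 7 * K0 + 2 * k + 2) * D.
Proof.
move=> K0E C0 k0 l0 a0 b0 te0 ts0 qq0 ua lb DE en h1 h2 h3 eea e1 h4 h5 e2 h6 h7.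
have C1 : 0 < C + 1 by rewrite ltr_wpDl.
have ki0 : 0 < k^-1 by rewrite invr_gt0.
have kk : k * k^-1 = 1 by rewrite mulfV // gt_eqF.
(* The Young weights for q and st are chosen so that, with lm <= C b, each product costs only half
   of b / k; C + 1 instead of C keeps the weight invertible. *)
have lk : (2 * (C + 1) * k)^-1 * lm <= 2^-1 * (k^-1 * b).
  rewrite invfM -mulrA invfM -!mulrA ler_pM2l ?invr_gt0 // ler_pdivrMl //.
  by rewrite [leRHS]mulrCA ler_pM2l // (le_trans lb) // ler_wpM2r // lerDl.
have rk : (2 * k)^-1 * b = 2^-1 * (k^-1 * b) by rewrite invfM mulrA.
(* Twice the energy identity, with a and b / k absorbed, leaves te + 2 (C + 1) k qq + 2 k ts; [K0]
   dominates each coefficient. *)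
have energy : a + k^-1 * b <= K0 * D.
  have h : a + k^-1 * b <= te + 2 * (C + 1) * k * qq + 2 * k * ts by lra.
  apply: le_trans h _; rewrite DE K0E.
  have Ck := mulr_ge0 C0 (ltW k0).
  have := mulr_ge0 Ck te0; have := mulr_ge0 Ck ts0.
  have := mulr_ge0 (ltW k0) te0; nra.
have b'0 : 0 <= k^-1 * b by rewrite mulr_ge0 // ltW.
have ale : a <= K0 * D by lra.
have ble : k^-1 * b <= K0 * D by lra.
have mle : mm <= 2 * D + 2 * (K0 * D) by rewrite {1}DE; lra.
have sle : k * ss <= 2 * (k^-1 * b) + 2 * (k * ts).
  have : k * (2 * p7) <= k * (2^-1 * ss + 2 * ts) by rewrite ler_pM2l.
  by move: h6; rewrite (mulrAC 2) (mulrC _ b); lra.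
have tsle : k * ts <= k * D by rewrite ler_pM2l // DE; lra.
have lu : l * u <= l * (C * (K0 * D)).
  by rewrite ler_wpM2l // (le_trans ua) // ler_wpM2l.
have llm : k^-1 * l * lm <= l * (C * (K0 * D)).
  rewrite mulrAC mulrC ler_wpM2l // (@le_trans _ _ (C * (k^-1 * b))) //.
    by rewrite mulrCA ler_pM2l.
  by rewrite ler_wpM2l.
(* The 7 counts the multiples of [K0 * D]: one each for a, ee and b / k, two each for k ss and
   mm. *)
have -> : (2 * l * C * K0 + 7 * K0 + 2 * k + 2) * D =
  l * (C * (K0 * D)) + l * (C * (K0 * D)) + 7 * (K0 * D) + 2 * (k * D) + 2 * D by ring.
lra.
Qed.

(** * Existence and stability for the full problem *)

Section well_posedness.
Context (R : realType) (n : nat) (Omega : set 'rV[R]_n.+1) (zeta kappa ell M : R).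
Hypotheses (mO : measurable Omega) (OM : Omega `<=` rV_box n.+1 M).
Hypotheses (k0 : 0 < kappa) (l0 : 0 < ell).
Local Notation E := 'rV[R]_n.+1.
Local Notation mu := (lebesgue_rV R n.+1).
Local Notation L2 := (L2 Omega).
Local Notation dot := (L2dot Omega).
Local Notation L2v := (L2v Omega).
Local Notation dotv := (L2dotv Omega).
Local Notation H1_0 := (H1_0 Omega).
Local Notation sol := (P_p_solution Omega zeta kappa).
Let H := prehilbert_L2 mO.
Let Hv := prehilbert_L2v mO.
Let H10 := prehilbert_H1_0 mO.
Let C := 16 * (M ^+ 2 + 1).
Let C0 : 0 <= C. Proof. by rewrite mulr_ge0 // addr_ge0 ?sqr_ge0. Qed.

Let dot0 f : L2 f -> dot f 0 = 0.
Proof. by move=> Lf; have := linear_on0 H (linear_dotr H Lf). Qed.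
Let dotv0 f : L2v f -> dotv f 0 = 0.
Proof. by move=> Lf; have := linear_on0 Hv (linear_dotr Hv Lf). Qed.
Let dot0l f : L2 f -> dot 0 f = 0.
Proof. by move=> Lf; have := linear_on0 H (linear_dotl H Lf). Qed.
Let dotv0l f : L2v f -> dotv 0 f = 0.
Proof. by move=> Lf; have := linear_on0 Hv (linear_dotl Hv Lf). Qed.
Let dotBr f g h : L2 f -> L2 g -> L2 h -> dot f (g - h) = dot f g - dot f h.
Proof. by move=> Lf Lg Lh; have := linear_onB H (linear_dotr H Lf) Lg Lh. Qed.
Let dotvBr f g h : L2v f -> L2v g -> L2v h -> dotv f (g - h) = dotv f g - dotv f h.
Proof. by move=> Lf Lg Lh; have := linear_onB Hv (linear_dotr Hv Lf) Lg Lh. Qed.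
Let dotBl f g h : L2 f -> L2 g -> L2 h -> dot (g - h) f = dot g f - dot h f.
Proof. by move=> Lf Lg Lh; have := linear_onB H (linear_dotl H Lf) Lg Lh. Qed.
Let dotvBl f g h : L2v f -> L2v g -> L2v h -> dotv (g - h) f = dotv g f - dotv h f.
Proof. by move=> Lf Lg Lh; have := linear_onB Hv (linear_dotl Hv Lf) Lg Lh. Qed.
Let H1_0_L2 w : H1_0 w -> L2 w.1 /\ L2v w.2.
Proof. by move=> /H1_0P[]. Qed.

Lemma solution_exists f : data Omega f -> exists2 x, X_p Omega x & sol f x.
Proof.
move: f => [[et st] q] [Let_ Lst Lq].
have poinc w : H1_0 w -> dot w.1 w.1 <= C * dotv w.2 w.2.
  exact: poincare_H1_0.
have [[[u Du] [lam Dlam]] [/= Hu Hl] [eq1 eq2]] :=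
  reduced_problem mO zeta C0 k0 poinc Let_ Lst Lq.
rewrite /= in eq1 eq2.
have [Lu LDu] := H1_0_L2 Hu; have [Ll LDl] := H1_0_L2 Hl; rewrite /= in Lu LDu Ll LDl.
have Lm : L2v (et - Du) by have := subspaceB Hv Let_ LDu.
have Ls : L2v (kappa^-1 *: Dlam + st) by have := prehilbertDZ Hv kappa^-1 LDl Lst.
have kk : kappa * kappa^-1 = 1 by rewrite mulfV // gt_eqF.
exists ((u, Du, Du, kappa^-1 *: Dlam + st), ((lam, Dlam), et - Du)) => //.
split.
  (* The terms in [de] and [ds] match identically; what remains is the first reduced equation tested
     with [du]. In the second equation e - grad u vanishes, which leaves the second reduced equation
     with opposite sign. *)
  move=> [[[du Ddu] de] ds] [Hdu Lde Lds] /=.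
  have [Ldu LDdu] := H1_0_L2 Hdu; have := eq1 _ Hdu; rewrite /= in Ldu LDdu *.
  rewrite dotvBr // !dotvBl // (dotDZl Hv) //.
  rewrite mulrDr mulrA kk mul1r => <-; ring.
move=> [[dl Ddl] dm] [Hdl Ldm] /=.
have [Ldl LDdl] := H1_0_L2 Hdl; have := eq2 _ Hdl; rewrite /= in Ldl LDdl *.
rewrite subrr dotv0 // (dotC Hv LDdl Ls) (dotDZl Hv) // (dotC H Ldl Lu).
by move=> h; rewrite addr0; move: h; lra.
Qed.

Lemma solution_sub f f' x x' : data Omega f -> data Omega f' ->
  X_p Omega x -> X_p Omega x' -> sol f x -> sol f' x' ->
  [/\ data Omega (f - f'), X_p Omega (x - x') & sol (f - f') (x - x')].
Proof.
move: f f' => [[et st] q] [[et' st'] q'] [L1 L2 L3] [L1' L2' L3'].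
move: x x' => [[[[u Du] e] s] [[l Dl] m]] [[[[u' Du'] e'] s'] [[l' Dl'] m']].
move=> [[Hu Le Ls] [Hl Lm]] [[Hu' Le' Ls'] [Hl' Lm']] [s1 s2] [s1' s2'].
have [Lu LDu] := H1_0_L2 Hu; have [Ll LDl] := H1_0_L2 Hl.
have [Lu' LDu'] := H1_0_L2 Hu'; have [Ll' LDl'] := H1_0_L2 Hl'.
rewrite /= in Lu LDu Ll LDl Lu' LDu' Ll' LDl'.
split.
- split.
  + by have := subspaceB Hv L1 L1'.
  + by have := subspaceB Hv L2 L2'.
  + by have := subspaceB H L3 L3'.
- split; split.
  + by have := subspaceB H10 Hu Hu'.
  + by have := subspaceB Hv Le Le'.
  + by have := subspaceB Hv Ls Ls'.
  + by have := subspaceB H10 Hl Hl'.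
  + by have := subspaceB Hv Lm Lm'.
split.
  move=> [[[du Ddu] de] ds] [Hdu Lde Lds] /=.
  have [Ldu LDdu] := H1_0_L2 Hdu; rewrite /= in Ldu LDdu.
  have := s1 (du, Ddu, de, ds) (And3 Hdu Lde Lds).
  have := s1' (du, Ddu, de, ds) (And3 Hdu Lde Lds).
  have LB : L2v (de - Ddu) by have := subspaceB Hv Lde LDdu.
  rewrite /= !dotvBl // !dotBl //; lra.
move=> [[dl Ddl] dm] [Hdl Ldm] /=.
have [Ldl LDdl] := H1_0_L2 Hdl; rewrite /= in Ldl LDdl.
have := s2 (dl, Ddl, dm) (conj Hdl Ldm).
have := s2' (dl, Ddl, dm) (conj Hdl Ldm).
rewrite /= !dotvBr // ?dotBr // ?dotBl //; try lra; try by have := subspaceB Hv Le Le'.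
by have := subspaceB Hv LDu LDu'.
Qed.

Lemma sqr_data_norm f : data_norm Omega f ^+ 2 =
  dotv f.1.1 f.1.1 + dotv f.1.2 f.1.2 + dot f.2 f.2.
Proof.
move: f => [[et st] q] /=.
by rewrite sqr_sqrtr ?addr_ge0 ?sqr_ge0 // !sqr_L2normv sqr_L2norm.
Qed.

Lemma sqr_X_p_norm x : X_p_norm Omega kappa ell x ^+ 2 =
  let: (((u, Du), e, s), ((lam, Dlam), m)) := x in
  ell ^- 2 * dot u u + dotv Du Du + dotv e e + kappa * dotv s s +
  (kappa^-1 * ell ^- 2 * dot lam lam + kappa^-1 * dotv Dlam Dlam + dotv m m).
Proof.
move: x => [[[[u Du] e] s] [[l Dl] m]].
have ki := ltW k0; have li : 0 <= ell ^- 2 by rewrite invr_ge0 exprn_ge0 // ltW.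
have ki' : 0 <= kappa^-1 by rewrite invr_ge0.
have h (p : E -> R) : 0 <= dot p p by rewrite -sqr_L2norm sqr_ge0.
have hv (F : E -> E) : 0 <= dotv F F by rewrite -sqr_L2normv sqr_ge0.
rewrite sqr_sqrtr ?addr_ge0 ?sqr_ge0 // /Y_p_norm /Z_p_norm /=.
rewrite !sqr_L2normv !sqr_L2norm sqr_sqrtr; last first.
  by apply: addr_ge0; [apply: addr_ge0 => //; apply: addr_ge0|]; rewrite ?mulr_ge0.
rewrite sqr_sqrtr //.
by apply: addr_ge0 => //; apply: addr_ge0; rewrite !mulr_ge0.
Qed.

Lemma stability : exists2 K : R, 0 <= K & forall f x,
  data Omega f -> X_p Omega x -> sol f x ->
  X_p_norm Omega kappa ell x ^+ 2 <= K * data_norm Omega f ^+ 2.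
Proof.
have li : 0 <= ell ^- 2 by rewrite invr_ge0 exprn_ge0 // ltW.
pose K0 := 1 + 2 * (C + 1) * kappa.
have K00 : 0 <= K0.
  by rewrite addr_ge0 // mulr_ge0 ?(ltW k0) // mulr_ge0 // addr_ge0.
exists (2 * ell ^- 2 * C * K0 + 7 * K0 + 2 * kappa + 2).
  have := ltW k0; have : 0 <= ell ^- 2 * C * K0.
    exact: mulr_ge0 (mulr_ge0 li C0) K00.
  by rewrite -!(mulrA 2); lra.
move=> [[et st] q] [[[[u Du] e] s] [[l Dl] m]] [Let_ Lst Lq].
move=> [[Hu Le Ls] [Hl Lm]] [s1 s2].
have [Lu LDu] := H1_0_L2 Hu; have [Ll LDl] := H1_0_L2 Hl.
rewrite /= in Lu LDu Ll LDl.
have Lv0 := prehilbert0 Hv; have H0 := prehilbert0 H10.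
(* The eliminated relations in weak form: [E1], [E2] and [E5] test with one free vector field in the
   slot of e, s or m, while [E3] and [E4] test with u and lambda themselves. *)
have E1 g : L2v g -> dotv e g + dotv m g = dotv et g.
  move=> Lg; have := s1 (0, 0, g, 0) (And3 H0 Lg Lv0).
  by rewrite /= subr0 !dotv0 // dot0 //; lra.
have E2 g : L2v g -> kappa * dotv s g - dotv Dl g = kappa * dotv st g.
  move=> Lg; have := s1 (0, 0, 0, g) (And3 H0 Lv0 Lg).
  by rewrite /= subr0 !dotv0 // dot0 //; lra.
have E3 : zeta * dot l u = dotv m Du.
  have := s1 (u, Du, 0, 0) (And3 Hu Lv0 Lv0).
  by rewrite /= dotvBr // !dotv0 //; lra.
have E4 : - dotv Dl s + zeta * dot l u = dot q l.
  have := s2 (l, Dl, 0) (conj Hl Lv0).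
  have LB : L2v (e - Du) by have := subspaceB Hv Le LDu.
  by rewrite /= dotv0l //; lra.
have E5 g : L2v g -> dotv g e = dotv g Du.
  move=> Lg; have := s2 (0, 0, g) (conj H0 Lg).
  by rewrite /= dotv0l // dot0l // dotvBr // dot0 //; lra.
have YN (t : R) g h : 0 < t -> L2v g -> L2v h ->
    - (2 * dotv g h) <= t * dotv g g + t^-1 * dotv h h.
  by move=> t0 Lg Lh; have := youngN Hv t0 Lg Lh.
have Y (t : R) g h : 0 < t -> L2v g -> L2v h ->
    2 * dotv g h <= t * dotv g g + t^-1 * dotv h h.
  by move=> t0 Lg Lh; have := young Hv t0 Lg Lh.
have k2 : 0 < kappa / 2 by rewrite divr_gt0.
have h2 : 0 < 2^-1 :> R by rewrite invr_gt0.
have t1 : 0 < (2 * (C + 1) * kappa)^-1.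
  by rewrite invr_gt0 mulr_gt0 // mulr_gt0 // ltr_wpDl.
have t2 : 0 < (2 * kappa)^-1 by rewrite invr_gt0 mulr_gt0.
rewrite sqr_data_norm sqr_X_p_norm /=.
have pu : dot u u <= C * dotv Du Du by have := poincare_H1_0 mO OM Hu.
have pl : dot l l <= C * dotv Dl Dl by have := poincare_H1_0 mO OM Hl.
have qB : - (2 * dot q l) <=
    (2 * (C + 1) * kappa)^-1 * dot l l + 2 * (C + 1) * kappa * dot q q.
  by have := youngN H t1 Ll Lq; rewrite invrK (dotC H Ll Lq).
apply: (@solution_norm_bound _ C kappa (ell ^- 2) _ (dotv Du Du) (dotv Dl Dl)
  _ _ _ _ _ (dotv et et) (dotv st st) (dot q q)
  (dotv et Du) (dot q l) (dotv st Dl) (dotv e m) (dotv et m)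
  (dotv s Dl) (dotv st s)) => //; rewrite ?(dot_ge0 Hv) ?(dot_ge0 H) //.
(* The energy identity: [E1] at grad u and [E2] at grad lambda are linked by [E3] and [E4], between
   which the term zeta (lambda, u) is eliminated. *)
- have := E1 _ LDu; have := E2 _ LDl; rewrite (dotC Hv Le LDu) E5 //.
  rewrite (dotC Hv Ls LDl) => e2 e1.
  have e3 : dotv Dl s = dotv st Dl + kappa^-1 * dotv Dl Dl.
    by apply: (mulfI (lt0r_neq0 k0)); rewrite mulrDr mulVKf ?lt0r_neq0 //; lra.
  by move: E3 E4 e1 e3; lra.
- by have := Y 1 _ _ ltr01 LDu Let_; rewrite invr1 !mul1r (dotC Hv LDu Let_).
- by have := YN _ _ _ t2 LDl Lst; rewrite invrK (dotC Hv LDl Lst).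
- by rewrite E5 // (dotC Hv Le LDu) E5.
- exact: E1.
- by have := Y _ _ _ h2 Lm Let_; rewrite invrK (dotC Hv Lm Let_).
- by have := YN _ _ _ h2 Lm Le; rewrite invrK (dotC Hv Lm Le).
- by have := E2 _ Ls; rewrite (dotC Hv LDl Ls); lra.
- by have := Y _ _ _ k2 Ls LDl; rewrite invf_div.
- by have := Y _ _ _ h2 Ls Lst; rewrite invrK (dotC Hv Ls Lst).
Qed.

End well_posedness.

Lemma L2dotv_eq0 (R : realType) (d : nat) (Omega : set 'rV[R]_d)
    (F : 'rV[R]_d -> 'rV[R]_d) : measurable Omega ->
  L2v Omega F -> L2dotv Omega F F = 0 -> ae_eq (lebesgue_rV R d) Omega F (cst 0).
Proof.
move=> mO LF F0.
have aei i : ae_eq (lebesgue_rV R d) Omega (fun x => F x 0 i) (cst 0).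
  apply: L2dot_eq0 => //; apply/eqP; rewrite eq_le (dot_ge0 (prehilbert_L2 mO)) // andbT.
  by rewrite -F0; exact: coord_le_L2dotv.
have : {ae lebesgue_rV R d, forall x, forall i, Omega x -> F x 0 i = 0}.
  exact: filter_forall aei.
apply: filterS => x h Ox.
by apply/rowP => i; rewrite mxE; exact: h.
Qed.

Lemma ae_eq_sub0 (R : realType) (d : nat) (Omega : set 'rV[R]_d) (V : zmodType)
    (f g : 'rV[R]_d -> V) :
  ae_eq (lebesgue_rV R d) Omega (f - g) (cst 0) -> ae_eq (lebesgue_rV R d) Omega f g.
Proof. by apply: filterS => x h Ox; apply/subr0_eq; exact: h. Qed.

Lemma X_p_eq_of_norm0 (R : realType) (n : nat) (Omega : set 'rV[R]_n.+1)
    (kappa ell : R) x x' : measurable Omega -> 0 < kappa -> 0 < ell ->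
  X_p Omega (x - x') -> X_p_norm Omega kappa ell (x - x') = 0 -> X_p_eq Omega x x'.
Proof.
move=> mO k0 l0; have H := prehilbert_L2 mO; have Hv := prehilbert_L2v mO.
move: x x' => [[[[u Du] e] s] [[l Dl] m]] [[[[u' Du'] e'] s'] [[l' Dl'] m']].
move=> [[/H1_0P[[Lu LDu] _ _] Le Ls] [/H1_0P[[Ll LDl] _ _] Lm]] /eqP.
rewrite -sqrf_eq0 sqr_X_p_norm //; rewrite /= in Lu LDu Ll LDl Le Ls Lm *.
have li : 0 < ell ^- 2 by rewrite invr_gt0 exprn_gt0.
have ki : 0 < kappa^-1 by rewrite invr_gt0.
have kl : 0 < kappa^-1 * ell ^- 2 by exact: mulr_gt0.
have hu := dot_ge0 H Lu; have hDu := dot_ge0 Hv LDu; have he := dot_ge0 Hv Le.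
have hs := dot_ge0 Hv Ls; have hl := dot_ge0 H Ll; have hDl := dot_ge0 Hv LDl.
have hm := dot_ge0 Hv Lm.
have p1 := mulr_ge0 (ltW li) hu; have p4 := mulr_ge0 (ltW k0) hs.
have p5 := mulr_ge0 (ltW kl) hl; have p6 := mulr_ge0 (ltW ki) hDl.
rewrite !paddr_eq0 ?addr_ge0 // !mulf_eq0 !(gt_eqF li) (gt_eqF k0) (gt_eqF ki) /=.
move=> /andP[/andP[/andP[/andP[/eqP zu /eqP zDu] /eqP ze] /eqP zs]].
move=> /andP[/andP[/eqP zl /eqP zDl] /eqP zm].
split; [split| | |split|]; apply: ae_eq_sub0.
- exact: L2dot_eq0.
- exact: L2dotv_eq0.
- exact: L2dotv_eq0.
- exact: L2dotv_eq0.
- exact: L2dot_eq0.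
- exact: L2dotv_eq0.
- exact: L2dotv_eq0.
Qed.

Unset Implicit Arguments.

Theorem theorem1 (R : realType) (d : nat) (hd : d = 2%N \/ d = 3%N)
  (Omega : set 'rV[R]_d) (hopen : open Omega) (hbounded : bounded_set Omega)
  (hconnected : connected Omega) (hLipschitz : Lipschitz_boundary Omega)
  (zeta kappa ell : R) (hzeta : 0 < zeta) (hkappa : 0 < kappa)
  (hell : 0 < ell) :
  well_posed (data Omega) (data_norm Omega)
    (X_p Omega) (X_p_norm Omega kappa ell) (X_p_eq Omega)
    (P_p_solution Omega zeta kappa).
Proof.
(* The Poincare inequality runs along coordinate 0, so the dimension must be a successor. *)
have [n dE] : exists n, d = n.+1 by case: hd => ->; [exists 1|exists 2].
subst d; clear hd hconnected hLipschitz.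
have mO := open_measurable_rV hopen.
have [M M0 OM] := bounded_rV_coord hbounded.
have [K K0 hK] := @stability R n Omega zeta kappa ell M mO OM hkappa hell.
split.
- exact: (solution_exists zeta mO OM hkappa).
- move=> f x x' Df Xx Xx' sx sx'.
  have [Dd Xd sd] := solution_sub mO Df Df Xx Xx' sx sx'.
  apply: (@X_p_eq_of_norm0 _ _ _ kappa ell) => //.
  have := hK _ _ Dd Xd sd; rewrite subrr sqr_data_norm.
  have H := prehilbert_L2 mO; have Hv := prehilbert_L2v mO.
  rewrite (linear_on0 Hv (linear_dotr Hv (prehilbert0 Hv))).
  rewrite (linear_on0 H (linear_dotr H (prehilbert0 H))) !addr0 mulr0 => le0.
  by apply/eqP; rewrite -sqrf_eq0 eq_le sqr_ge0 andbT.
move=> f x Df Xx sx eps eps0; have K1 : 0 < K + 1 by rewrite ltr_wpDl.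
(* Stability bounds squares, and K <= (K + 1)^2, so this choice avoids a square root of [K]. *)
exists (eps / (K + 1)); first exact: divr_gt0.
move=> f' x' Df' Xx' sx'; rewrite ltr_pdivlMr // => fx.
have [Dd Xd sd] := solution_sub mO Df' Df Xx' Xx sx' sx.
have := hK _ _ Dd Xd sd.
have data0 : 0 <= data_norm Omega (f' - f).
  by case: (f' - f) => -[? ?] ?; exact: sqrtr_ge0.
have X0 : 0 <= X_p_norm Omega kappa ell (x' - x) by exact: sqrtr_ge0.
move: (X_p_norm _ _ _ _) (data_norm _ _) X0 data0 fx => X D X0 D0 fx h.
rewrite -ltr_sqr ?nnegrE ?(ltW eps0) //; apply: le_lt_trans h _.
have : (D * (K + 1)) ^+ 2 < eps ^+ 2.
  by rewrite ltr_sqr ?nnegrE ?(ltW eps0) // mulr_ge0 // ltW.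
apply: le_lt_trans; have := sqr_ge0 D; have := mulr_ge0 K0 (sqr_ge0 D).
have := mulr_ge0 (sqr_ge0 K) (sqr_ge0 D); lra.
Qed.
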